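(* Let $a\in(0,\tfrac12)$. For every $E\in[0,1]$ there exists a unique $\lambda=\Lambda(E)\in[-1-a,-1+a]$ such that the $\Theta$-flow described in the context has a saddles connector going from $(0,0)$ to $(\pi,-\pi)$. Moreover, $\Lambda$ is an increasing $C^1$ function and $\frac{d\Lambda}{dE}<a$.
   Context: For $a\in(0,\tfrac12)$, $E\in[0,1]$, $\lambda\in\mathbb R$, the $\Theta$-flow is the system on the strip $[0,\pi]\times\mathbb R$ (with $\Theta$ understood mod $2\pi$ on the cylinder) $$\dot\theta=\sin\theta,\qquad \dot\Theta=-2a\sin\theta\cos\theta\cos\Theta+2aE\sin^2\theta\sin\Theta-\sin\Theta+2\lambda\sin\theta,$$ (the angular Prüfer equation of the separated Dirac equation with $\kappa=\tfrac12$, in units $m=1$). A saddles connector from $(0,0)$ to $(\pi,-\pi)$ is an orbit in $(0,\pi)\times\mathbb R$ whose $\alpha$-limit is the saddle $(0,0)$ and whose $\omega$-limit is the saddle $(\pi,-\pi)$. *)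

(* Defs.v *)
From Stdlib Require Import Reals Lra.
From Coquelicot Require Import Coquelicot.
Open Scope R_scope.

Definition Theta_rhs (a E lam th Th : R) : R :=
  - 2 * a * sin th * cos th * cos Th + 2 * a * E * (sin th) ^ 2 * sin Th
  - sin Th + 2 * lam * sin th.

Definition is_saddles_connector (a E lam : R) (th Th : R -> R) : Prop :=
  (forall t, 0 < th t < PI) /\
  (forall t, is_derive th t (sin (th t))) /\
  (forall t, is_derive Th t (Theta_rhs a E lam (th t) (Th t))) /\
  filterlim th (Rbar_locally m_infty) (locally 0) /\
  filterlim Th (Rbar_locally m_infty) (locally 0) /\
  filterlim th (Rbar_locally p_infty) (locally PI) /\
  filterlim Th (Rbar_locally p_infty) (locally (- PI)).

Definition has_saddles_connector (a E lam : R) : Prop :=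
  exists th Th : R -> R, is_saddles_connector a E lam th Th.

Definition I01 (x : R) : Prop := 0 <= x <= 1.

Definition is_derive_on_01 (f f' : R -> R) : Prop :=
  forall E, I01 E ->
    filterlim (fun x => (f x - f E) / (x - E))
      (within (fun x => I01 x /\ x <> E) (locally E)) (locally (f' E)).

Definition continuous_on_01 (g : R -> R) : Prop :=
  forall E, I01 E -> filterlim g (within I01 (locally E)) (locally (g E)).

(* Main.v *)
(* Put m = - lambda and u = sin^2(theta/2).  Writing
   Theta = - 2 atan (sqrt (u (1 - u)) g / f) turns the flow into the linear
   system
     f' = - 2 a E f - (m - a + 2 a u) g,
     (1 - u) (u g)' = (m + a - 2 a u) f + 2 a E u (1 - u) g,
   whose solution regular at u = 0 is a power series of radius at least 1 and
   describes the unstable manifold of (0, 0).  Since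
   (theta, Theta)(t) -> (PI - theta, - PI - Theta)(- t) preserves the flow,
   there is a connector as soon as f > 0 on [0, 1/2] and g = 2 f at u = 1/2.
   The supremum of the m for which f > 0 on [0, 1/2] and g <= 2 f at 1/2
   satisfies this condition.

   For two connectors, the difference of the angles solves a linear equation
   whose rates at the two saddles have opposite signs, so that it cannot vanish
   at both ends if the forcing has a sign; whence uniqueness and
   |Lambda E1 - Lambda E2| <= a |E1 - E2|.  Finally the Wronskian
   u (f1 g2 - f2 g1) vanishes at 0 and 1/2, and integrating its derivative
   expresses the difference quotient of Lambda as a ratio of two bilinear forms
   in the solutions, which depend continuously on the parameters. *)

Require Import Defs.
From Stdlib Require Import Reals Lra.
From Stdlib Require Import FunctionalExtensionality ClassicalEpsilon.
From Coquelicot Require Import Coquelicot.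
Open Scope R_scope.

(** * The power series solution *)

(* The Taylor coefficients f_n, g_n and g_{n-1}. *)
Fixpoint coef (a m E : R) (n : nat) : R * R * R :=
  match n with
  | O => (1, m + a, 0)
  | S k =>
      let '(f, g, h) := coef a m E k in
      let f1 := (- 2 * a * E * f - (m - a) * g - 2 * a * h) / (INR k + 1) in
      (f1,
       ((INR k + 1) * g + (m + a) * f1 - 2 * a * f + 2 * a * E * (g - h))
         / (INR k + 2),
       g)
  end.

Definition fcoef a m E n := fst (fst (coef a m E n)).
Definition gcoef a m E n := snd (fst (coef a m E n)).

(* 40 is large enough to dominate both the coefficients and their Lipschitz
   constants in (m, E), see [coef_step]. *)
Fixpoint major (n : nat) : R :=
  match n with
  | O => 3
  | S k => major k * (1 + 40 / (INR k + 1))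
  end.

Lemma coef_third a m E n : snd (coef a m E n) = PS_incr_1 (gcoef a m E) n.
Proof.
  destruct n as [|n]; [reflexivity|].
  unfold gcoef; simpl; destruct (coef a m E n) as [[f g] h]; reflexivity.
Qed.

(** This is the coefficient of u^n in the equation for f', since [PS_incr_1] multiplies a series by
    u. *)
Lemma fcoef_S a m E n :
  (INR n + 1) * fcoef a m E (S n) =
  - 2 * a * E * fcoef a m E n - (m - a) * gcoef a m E n
  - 2 * a * PS_incr_1 (gcoef a m E) n.
Proof.
  rewrite <- coef_third; unfold fcoef, gcoef; simpl.
  destruct (coef a m E n) as [[f g] h]; simpl.
  pose proof (pos_INR n); field; lra.
Qed.

(** This is the coefficient of u^(n+1) in the equation for (1 - u) (u g)'. The coefficient of u^0
    only says g_0 = m + a, which is the initial value in [coef]. *)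
Lemma gcoef_S a m E n :
  (INR n + 2) * gcoef a m E (S n) =
  (INR n + 1) * gcoef a m E n + (m + a) * fcoef a m E (S n)
  - 2 * a * fcoef a m E n
  + 2 * a * E * (gcoef a m E n - PS_incr_1 (gcoef a m E) n).
Proof.
  rewrite <- coef_third; unfold fcoef, gcoef; simpl.
  destruct (coef a m E n) as [[f g] h]; simpl.
  pose proof (pos_INR n); field; lra.
Qed.

Lemma major_pos n : 0 < major n.
Proof.
  induction n as [|n IH]; simpl; [lra|].
  apply Rmult_lt_0_compat; [assumption|].
  pose proof (pos_INR n).
  assert (0 < 40 / (INR n + 1)) by (apply Rdiv_lt_0_compat; lra); lra.
Qed.

Lemma major_S n : major n <= major (S n).
Proof.
  simpl; pose proof (major_pos n); pose proof (pos_INR n).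
  assert (0 < 40 / (INR n + 1)) by (apply Rdiv_lt_0_compat; lra); nra.
Qed.

Lemma Rabs_mult_le x y X Y :
  Rabs x <= X -> Rabs y <= Y -> Rabs (x * y) <= X * Y.
Proof.
  intros; rewrite Rabs_mult; apply Rmult_le_compat; auto using Rabs_pos.
Qed.

(* The remainders [r] and [r'] vanish for a solution of the recursion and
   absorb the parameter variation for a difference of two solutions. *)
Lemma coef_step a m E n f g h f1 g1 r r' M :
  0 < a < 1 / 2 -> 0 <= m <= 2 -> 0 <= E <= 1 ->
  Rabs f <= M -> Rabs g <= M -> Rabs h <= M ->
  Rabs r <= 2 * M -> Rabs r' <= 9 * M ->
  (INR n + 1) * f1 = - 2 * a * E * f - (m - a) * g - 2 * a * h + r ->
  (INR n + 2) * g1 =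
    (INR n + 1) * g + (m + a) * f1 - 2 * a * f + 2 * a * E * (g - h) + r' ->
  Rabs f1 <= 7 * M /\ Rabs f1 <= M * (1 + 40 / (INR n + 1)) /\
  Rabs g1 <= M * (1 + 40 / (INR n + 1)).
Proof.
  intros Ha Hm HE Hf Hg Hh Hr Hr' E1 E2.
  pose proof (pos_INR n) as Hn; set (N := INR n) in *.
  assert (HM : 0 <= M) by (eapply Rle_trans; [apply Rabs_pos|apply Hf]).
  assert (aE : 0 <= 2 * a * E <= 1) by nra.
  assert (B1 : Rabs ((2 * a * E) * f) <= 1 * M)
    by (apply Rabs_mult_le; auto; apply Rabs_le; lra).
  assert (B2 : Rabs ((m - a) * g) <= 2 * M)
    by (apply Rabs_mult_le; auto; apply Rabs_le; lra).
  assert (B3 : Rabs ((2 * a) * h) <= 1 * M)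
    by (apply Rabs_mult_le; auto; apply Rabs_le; lra).
  assert (B4 : Rabs ((2 * a) * f) <= 1 * M)
    by (apply Rabs_mult_le; auto; apply Rabs_le; lra).
  assert (B5 : Rabs ((2 * a * E) * g) <= 1 * M)
    by (apply Rabs_mult_le; auto; apply Rabs_le; lra).
  assert (B6 : Rabs ((2 * a * E) * h) <= 1 * M)
    by (apply Rabs_mult_le; auto; apply Rabs_le; lra).
  (* The right side of the first recursion is at most (1 + 2 + 1 + 2) M, so 7 leaves some slack. *)
  assert (F : Rabs f1 <= 7 * M / (N + 1)).
  { apply Rmult_le_reg_l with (N + 1); [lra|].
    replace ((N + 1) * (7 * M / (N + 1))) with (7 * M) by (field; lra).
    rewrite <- (Rabs_pos_eq (N + 1)) at 1 by lra.
    rewrite <- Rabs_mult, E1.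
    apply Rabs_le_between in B1, B2, B3, Hr; apply Rabs_le; lra. }
  assert (Q : 7 * M / (N + 1) <= 7 * M).
  { apply Rmult_le_reg_l with (N + 1); [lra|].
    replace ((N + 1) * (7 * M / (N + 1))) with (7 * M) by (field; lra). nra. }
  assert (Q' : M * (1 + 40 / (N + 1)) = M + 40 / 7 * (7 * M / (N + 1)))
    by (field; lra).
  assert (Q0 : 0 <= 7 * M / (N + 1))
    by (eapply Rle_trans; [apply Rabs_pos|apply F]).
  split; [lra|split; [lra|]].
  assert (B7 : Rabs ((m + a) * f1) <= 3 * (7 * M))
    by (apply Rabs_mult_le; [apply Rabs_le|]; lra).
  assert (B8 : Rabs ((N + 1) * g) <= (N + 1) * M)
    by (apply Rabs_mult_le; [rewrite Rabs_pos_eq|]; lra).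
  (* The terms other than (N + 1) g add up to at most (21 + 1 + 1 + 1 + 9) M = 33 M, below the 40 M
     that the majorant offers. *)
  apply Rmult_le_reg_l with (N + 2); [lra|].
  rewrite <- (Rabs_pos_eq (N + 2)) at 1 by lra.
  rewrite <- Rabs_mult, E2.
  assert ((N + 2) * (M * (1 + 40 / (N + 1)))
    = (N + 2) * M + 40 * M + 40 * M / (N + 1)) by (field; lra).
  assert (0 <= 40 * M / (N + 1)) by (unfold Rdiv in *; nra).
  apply Rabs_le_between in B4, B5, B6, B7, B8, Hr'; apply Rabs_le; lra.
Qed.

(** Induction with [coef_step] and zero remainders. The last bound, on f_(n+1) in terms of the
    majorant at n, controls the term (m - m') f_(n+1) that appears when two recursions are
    subtracted. *)
Lemma coef_bound a m E n :
  0 < a < 1 / 2 -> 0 <= m <= 2 -> 0 <= E <= 1 ->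
  Rabs (fcoef a m E n) <= major n /\ Rabs (gcoef a m E n) <= major n /\
  Rabs (PS_incr_1 (gcoef a m E) n) <= major n /\
  Rabs (fcoef a m E (S n)) <= 7 * major n.
Proof.
  intros Ha Hm HE.
  assert (Z : forall c k, 0 <= c -> Rabs 0 <= c * major k)
    by (intros c k; rewrite Rabs_R0; pose proof (major_pos k); nra).
  assert (D : forall n, Rabs (fcoef a m E n) <= major n /\
    Rabs (gcoef a m E n) <= major n /\
    Rabs (PS_incr_1 (gcoef a m E) n) <= major n).
  { intros k; induction k as [|k (F & G & H)].
    - unfold fcoef, gcoef; simpl; repeat split; apply Rabs_le;
        try change zero with 0; lra.
    - destruct (coef_step a m E k _ _ _ (fcoef a m E (S k)) (gcoef a m E (S k))
        0 0 _ Ha Hm HE F G H (Z 2 _ ltac:(lra)) (Z 9 _ ltac:(lra)))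
        as (_ & F' & G').
      + rewrite fcoef_S; ring.
      + rewrite gcoef_S; ring.
      + split; [exact F'|split; [exact G'|]].
        apply Rle_trans with (1 := G), major_S. }
  destruct (D n) as (F & G & H); repeat split; auto.
  apply (coef_step a m E n _ _ _ (fcoef a m E (S n)) (gcoef a m E (S n))
    0 0 _ Ha Hm HE F G H (Z 2 _ ltac:(lra)) (Z 9 _ ltac:(lra))).
  + rewrite fcoef_S; ring.
  + rewrite gcoef_S; ring.
Qed.

(** The difference of two coefficient sequences obeys the recursion for (m, E) with remainders that
    are linear in m - m' and E - E'. These are bounded through [coef_bound], so [coef_step] applies
    with M = d * [major] n. *)
Lemma coef_lipschitz a m E m' E' n :
  0 < a < 1 / 2 -> 0 <= m <= 2 -> 0 <= E <= 1 -> 0 <= m' <= 2 -> 0 <= E' <= 1 ->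
  let d := Rabs (m - m') + Rabs (E - E') in
  Rabs (fcoef a m E n - fcoef a m' E' n) <= d * major n /\
  Rabs (gcoef a m E n - gcoef a m' E' n) <= d * major n.
Proof.
  intros Ha Hm HE Hm' HE' d.
  assert (dm : Rabs (m - m') <= d)
    by (unfold d; pose proof (Rabs_pos (E - E')); lra).
  assert (dE : Rabs (E - E') <= d)
    by (unfold d; pose proof (Rabs_pos (m - m')); lra).
  assert (d0 : 0 <= d) by (eapply Rle_trans; [apply Rabs_pos|apply dm]).
  clearbody d.
  enough (D : Rabs (fcoef a m E n - fcoef a m' E' n) <= d * major n /\
    Rabs (gcoef a m E n - gcoef a m' E' n) <= d * major n /\
    Rabs (PS_incr_1 (gcoef a m E) n - PS_incr_1 (gcoef a m' E') n)
      <= d * major n) by tauto.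
  induction n as [|n (F & G & H)].
  - unfold fcoef, gcoef; simpl; change zero with 0.
    apply Rabs_le_between in dm.
    repeat split; apply Rabs_le; lra.
  - destruct (coef_bound a m' E' n Ha Hm' HE') as (F0 & G0 & H0 & F1).
    pose proof (major_pos n) as Mp.
    assert (B1 : Rabs ((2 * a) * (E - E') * fcoef a m' E' n)
      <= (1 * d) * major n)
      by (repeat apply Rabs_mult_le; auto; apply Rabs_le; lra).
    assert (B2 : Rabs ((m - m') * gcoef a m' E' n) <= d * major n)
      by (repeat apply Rabs_mult_le; auto; apply Rabs_le; lra).
    assert (B3 : Rabs ((m - m') * fcoef a m' E' (S n)) <= d * (7 * major n))
      by (repeat apply Rabs_mult_le; auto; apply Rabs_le; lra).
    assert (B4 : Rabs ((2 * a) * (E - E') * gcoef a m' E' n)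
      <= (1 * d) * major n)
      by (repeat apply Rabs_mult_le; auto; apply Rabs_le; lra).
    assert (B5 : Rabs ((2 * a) * (E - E') * PS_incr_1 (gcoef a m' E') n)
      <= (1 * d) * major n)
      by (repeat apply Rabs_mult_le; auto; apply Rabs_le; lra).
    apply Rabs_le_between in B1, B2, B3, B4, B5.
    destruct (coef_step a m E n _ _ _
      (fcoef a m E (S n) - fcoef a m' E' (S n))
      (gcoef a m E (S n) - gcoef a m' E' (S n))
      (- ((2 * a) * (E - E') * fcoef a m' E' n) - (m - m') * gcoef a m' E' n)
      ((m - m') * fcoef a m' E' (S n) + (2 * a) * (E - E') * gcoef a m' E' n
       - (2 * a) * (E - E') * PS_incr_1 (gcoef a m' E') n)
      _ Ha Hm HE F G H) as (_ & F' & G').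
    + apply Rabs_le; lra.
    + apply Rabs_le; lra.
    + rewrite Rmult_minus_distr_l, 2!fcoef_S; ring.
    + rewrite Rmult_minus_distr_l, 2!gcoef_S; ring.
    + simpl major; rewrite <- !Rmult_assoc.
      split; [exact F'|split; [exact G'|]].
      apply Rle_trans with (1 := G).
      rewrite Rmult_assoc; apply Rmult_le_compat_l; [assumption|apply major_S].
Qed.

(** * Convergence of the series and the linear system *)

Lemma ex_series_major x :
  0 <= x < 1 -> ex_series (fun n => major n * x ^ n).
Proof.
  intros Hx.
  apply ex_series_Rabs, (CV_disk_DAlembert major x 1).
  - intros n; pose proof (major_pos n); lra.
  (* The ratio of consecutive majorants is 1 + 40 / (n + 1), which tends to 1, so the radius is at
     least 1. *)
  - apply is_lim_seq_ext with (fun n => 1 + 40 * / INR (S n)).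
    { intros n; rewrite S_INR; simpl major.
      pose proof (major_pos n); pose proof (pos_INR n).
      rewrite Rabs_pos_eq.
      - field; split; lra.
      - replace (_ / _) with (1 + 40 / (INR n + 1)) by (field; lra).
        assert (0 < 40 / (INR n + 1)) by (apply Rdiv_lt_0_compat; lra); lra. }
    replace (Finite 1) with (Finite (1 + 40 * 0)) by (f_equal; ring).
    apply is_lim_seq_plus'; [apply is_lim_seq_const|].
    apply is_lim_seq_mult'; [apply is_lim_seq_const|].
    apply (is_lim_seq_incr_1 (fun n => / INR n)).
    evar_last. apply is_lim_seq_inv. apply is_lim_seq_INR. discriminate. reflexivity.
  - right; split; [lra|]. rewrite Rabs_pos_eq, Rinv_1; lra.
Qed.

Definition sol_f a m E (u : R) := PSeries (fcoef a m E) u.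
Definition sol_g a m E (u : R) := PSeries (gcoef a m E) u.

Lemma Rabs_coef_mult_le (c : nat -> R) C x n :
  Rabs (c n) <= C * major n -> Rabs (c n * x ^ n) <= C * (major n * Rabs x ^ n).
Proof.
  intros H; rewrite Rabs_mult, <- RPow_abs, <- Rmult_assoc.
  apply Rmult_le_compat_r; [apply pow_le, Rabs_pos|assumption].
Qed.

Lemma ex_series_dominated (c : nat -> R) C x :
  Rabs x < 1 -> (forall n, Rabs (c n) <= C * major n) ->
  ex_series (fun n => Rabs (c n * x ^ n)).
Proof.
  intros Hx H.
  apply (@ex_series_le R_AbsRing R_CompleteNormedModule) with
    (fun n => C * (major n * Rabs x ^ n)).
  - intros n; simpl; unfold norm; simpl; unfold abs; simpl.
    rewrite Rabs_Rabsolu; apply Rabs_coef_mult_le, H.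
  - apply (ex_series_scal_l C (fun n => major n * Rabs x ^ n)), ex_series_major.
    pose proof (Rabs_pos x); lra.
Qed.

(** Bounds on [0, 1/2] are enough: u = 1/2 corresponds to theta = PI / 2, and the other half of the
    orbit comes from the symmetry. *)
Lemma PSeries_dominated (c : nat -> R) C x :
  0 <= x <= 1 / 2 -> 0 <= C -> (forall n, Rabs (c n) <= C * major n) ->
  Rabs (PSeries c x) <= C * PSeries major (1 / 2).
Proof.
  intros Hx HC H.
  unfold PSeries.
  apply Rle_trans with (1 := Series_Rabs _
    (ex_series_dominated c C x ltac:(rewrite Rabs_pos_eq; lra) H)).
  rewrite <- Series_scal_l; apply Series_le.
  - intros n; split; [apply Rabs_pos|].
    apply Rle_trans with (1 := Rabs_coef_mult_le c C x n (H n)).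
    apply Rmult_le_compat_l; [assumption|].
    apply Rmult_le_compat_l; [apply Rlt_le, major_pos|].
    apply pow_incr; rewrite Rabs_pos_eq; lra.
  - apply (ex_series_scal_l C (fun n => major n * (1 / 2) ^ n)), ex_series_major.
    lra.
Qed.

Lemma CV_radius_dominated (c : nat -> R) x :
  Rabs x < 1 -> (forall n, Rabs (c n) <= major n) ->
  Rbar_lt (Rabs x) (CV_radius c).
Proof.
  intros Hx H.
  (* The midpoint of |x| and 1 is still a point of absolute convergence, which makes the inequality
     strict. *)
  apply Rbar_lt_le_trans with ((Rabs x + 1) / 2); [simpl; lra|].
  apply (proj1 (Lub_Rbar_correct (CV_disk c))).
  apply ex_series_dominated with 1.
  - pose proof (Rabs_pos x); rewrite Rabs_pos_eq; lra.
  - intros n; rewrite Rmult_1_l; apply H.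
Qed.

Lemma sol_f_0 a m E : sol_f a m E 0 = 1.
Proof. apply PSeries_0. Qed.

Lemma sol_g_0 a m E : sol_g a m E 0 = m + a.
Proof. apply PSeries_0. Qed.

Lemma sol_f_derive a m E u :
  0 < a < 1 / 2 -> 0 <= m <= 2 -> 0 <= E <= 1 -> Rabs u < 1 ->
  is_derive (sol_f a m E) u
    (- 2 * a * E * sol_f a m E u - (m - a + 2 * a * u) * sol_g a m E u).
Proof.
  intros Ha Hm HE Hu.
  assert (Rf : Rbar_lt (Rabs u) (CV_radius (fcoef a m E)))
    by (apply CV_radius_dominated; [|intros n; apply coef_bound]; auto).
  assert (Rg : Rbar_lt (Rabs u) (CV_radius (gcoef a m E)))
    by (apply CV_radius_dominated; [|intros n; apply coef_bound]; auto).
  assert (If := PSeries_correct _ _ (CV_radius_inside _ _ Rf)).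
  assert (Ig := PSeries_correct _ _ (CV_radius_inside _ _ Rg)).
  assert (Ih := is_pseries_incr_1 _ _ _ Ig).
  evar_last. apply is_derive_PSeries, Rf.
  apply is_pseries_unique.
  apply is_pseries_ext with
    (PS_plus (PS_plus (PS_scal (- 2 * a * E) (fcoef a m E))
       (PS_scal (- (m - a)) (gcoef a m E)))
       (PS_scal (- 2 * a) (PS_incr_1 (gcoef a m E)))).
  { intros n; unfold PS_derive, PS_plus, PS_scal, plus, scal.
    cbn -[INR fcoef gcoef PS_incr_1]; unfold mult; cbn -[INR fcoef gcoef PS_incr_1].
    rewrite S_INR, fcoef_S; ring. }
  evar_last.
  - apply is_pseries_plus; [apply is_pseries_plus|];
      (apply is_pseries_scal; [apply Rmult_comm|]); eassumption.
  - unfold sol_f, sol_g, plus, scal; simpl; unfold mult; simpl; ring.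
Qed.

Lemma sol_g_ex_derive a m E u :
  0 < a < 1 / 2 -> 0 <= m <= 2 -> 0 <= E <= 1 -> Rabs u < 1 ->
  ex_derive (sol_g a m E) u.
Proof.
  intros Ha Hm HE Hu; apply ex_derive_PSeries.
  apply CV_radius_dominated; [|intros n; apply coef_bound]; auto.
Qed.

(** Differentiating u g instead of g avoids a division by u at the singular point 0. The equation is
    first checked as an identity of power series after multiplication by 1 - u, then divided. *)
Lemma sol_ug_derive a m E u :
  0 < a < 1 / 2 -> 0 <= m <= 2 -> 0 <= E <= 1 -> Rabs u < 1 ->
  is_derive (fun x => x * sol_g a m E x) u
    ((m + a - 2 * a * u) / (1 - u) * sol_f a m E u
     + 2 * a * E * (u * sol_g a m E u)).
Proof.
  intros Ha Hm HE Hu.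
  assert (Rf : Rbar_lt (Rabs u) (CV_radius (fcoef a m E)))
    by (apply CV_radius_dominated; [|intros n; apply coef_bound]; auto).
  assert (Rg : Rbar_lt (Rabs u) (CV_radius (gcoef a m E)))
    by (apply CV_radius_dominated; [|intros n; apply coef_bound]; auto).
  assert (Rh : Rbar_lt (Rabs u) (CV_radius (PS_incr_1 (gcoef a m E))))
    by (rewrite CV_radius_incr_1; apply Rg).
  assert (If := PSeries_correct _ _ (CV_radius_inside _ _ Rf)).
  assert (Jf := is_pseries_incr_1 _ _ _ If).
  assert (Ig := PSeries_correct _ _ (CV_radius_inside _ _ Rg)).
  assert (Ih := is_pseries_incr_1 _ _ _ Ig).
  assert (Jh := is_pseries_incr_1 _ _ _ Ih).
  assert (Id := PSeries_correct _ _ (ex_pseries_derive _ _ Rh)).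
  assert (Jd := is_pseries_incr_1 _ _ _ Id).
  set (D := PSeries (PS_derive (PS_incr_1 (gcoef a m E))) u) in *.
  assert (K : (1 - u) * D = (m + a - 2 * a * u) * sol_f a m E u
     + 2 * a * E * (1 - u) * (u * sol_g a m E u)).
  { transitivity (PSeries (PS_plus (PS_plus
       (PS_scal (m + a) (fcoef a m E)) (PS_scal (- 2 * a) (PS_incr_1 (fcoef a m E))))
       (PS_plus (PS_scal (2 * a * E) (PS_incr_1 (gcoef a m E)))
         (PS_scal (- 2 * a * E) (PS_incr_1 (PS_incr_1 (gcoef a m E)))))) u).
    - symmetry; apply is_pseries_unique.
      apply is_pseries_ext with (PS_plus (PS_derive (PS_incr_1 (gcoef a m E)))
        (PS_scal (- 1) (PS_incr_1 (PS_derive (PS_incr_1 (gcoef a m E)))))).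
      { intros [|n]; unfold PS_derive, PS_plus, PS_scal, plus, scal;
          cbn -[INR fcoef gcoef]; unfold mult; cbn -[INR fcoef gcoef].
        - unfold zero, fcoef, gcoef; simpl; ring.
        - assert (H := gcoef_S a m E n); unfold PS_incr_1 in H.
          rewrite !S_INR.
          replace (INR n + 1 + 1) with (INR n + 2) by ring.
          rewrite H; destruct n; simpl; ring. }
      evar_last.
      + apply is_pseries_plus; [eassumption|].
        apply is_pseries_scal; [apply Rmult_comm|]; eassumption.
      + unfold plus, scal; simpl; unfold mult; simpl; ring.
    - apply is_pseries_unique; evar_last.
      + apply is_pseries_plus; apply is_pseries_plus;
          (apply is_pseries_scal; [apply Rmult_comm|]); eassumption.
      + unfold sol_f, sol_g, plus, scal; simpl; unfold mult; simpl; ring. }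
  apply is_derive_ext with (PSeries (PS_incr_1 (gcoef a m E))).
  { intros x; apply PSeries_incr_1. }
  evar_last. apply is_derive_PSeries, Rh. fold D.
  apply Rabs_lt_between in Hu.
  apply Rmult_eq_reg_l with (1 - u); [|lra].
  rewrite K; field; lra.
Qed.

(** This constant bounds f and g on [0, 1/2] uniformly in the parameters. It is also their Lipschitz
    constant in (m, E), because [coef_lipschitz] uses the same majorant. *)
Definition sol_bound := 1 + PSeries major (1 / 2).

Lemma sol_bound_pos : 0 < sol_bound.
Proof.
  unfold sol_bound.
  (* The zero series is dominated by [major], so this bound shows that the sum of the majorant is
     nonnegative. *)
  assert (H := PSeries_dominated (fun _ => 0) 1 0 ltac:(lra) ltac:(lra)).
  assert (0 <= PSeries major (1 / 2)); [|lra].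
  rewrite Rmult_1_l in H; eapply Rle_trans; [apply Rabs_pos|apply H].
  intros n; rewrite Rabs_R0; pose proof (major_pos n); lra.
Qed.

Lemma sol_bounded a m E u :
  0 < a < 1 / 2 -> 0 <= m <= 2 -> 0 <= E <= 1 -> 0 <= u <= 1 / 2 ->
  Rabs (sol_f a m E u) <= sol_bound /\ Rabs (sol_g a m E u) <= sol_bound.
Proof.
  intros Ha Hm HE Hu.
  assert (forall c : nat -> R, (forall n, Rabs (c n) <= major n) ->
    Rabs (PSeries c u) <= sol_bound).
  { intros c Hc.
    apply Rle_trans with (1 * PSeries major (1 / 2)); [|unfold sol_bound; lra].
    apply PSeries_dominated; try lra.
    intros n; rewrite Rmult_1_l; apply Hc. }
  split; apply H; intros n; apply coef_bound; auto.
Qed.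

Lemma sol_lipschitz a m E m' E' u :
  0 < a < 1 / 2 -> 0 <= m <= 2 -> 0 <= E <= 1 -> 0 <= m' <= 2 -> 0 <= E' <= 1 ->
  0 <= u <= 1 / 2 ->
  let d := Rabs (m - m') + Rabs (E - E') in
  Rabs (sol_f a m E u - sol_f a m' E' u) <= d * sol_bound /\
  Rabs (sol_g a m E u - sol_g a m' E' u) <= d * sol_bound.
Proof.
  intros Ha Hm HE Hm' HE' Hu d.
  assert (Hd : 0 <= d)
    by (unfold d; pose proof (Rabs_pos (m - m')); pose proof (Rabs_pos (E - E')); lra).
  assert (ex : forall c : nat -> R, (forall n, Rabs (c n) <= major n) ->
     ex_pseries c u).
  { intros c Hc; apply CV_radius_inside, CV_radius_dominated; auto.
    rewrite Rabs_pos_eq; lra. }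
  assert (P : forall c c' : nat -> R, (forall n, Rabs (c n) <= major n) ->
    (forall n, Rabs (c' n) <= major n) ->
    (forall n, Rabs (c n - c' n) <= d * major n) ->
    Rabs (PSeries c u - PSeries c' u) <= d * sol_bound).
  { intros c c' Hc Hc' Hcc'.
    rewrite <- PSeries_minus by auto.
    apply Rle_trans with (d * PSeries major (1 / 2));
      [|unfold sol_bound; nra].
    apply PSeries_dominated; auto. }
  split; apply P; intros n; first [apply coef_bound; auto|apply coef_lipschitz; auto].
Qed.

(** * Comparison of two connectors *)

Lemma derive_pos_incr (h dh : R -> R) x y :
  (forall t, is_derive h t (dh t)) -> (forall t, x < t < y -> 0 < dh t) ->
  x < y -> h x < h y.
Proof.
  intros Hd Hp Hxy.
  destruct (MVT_cor2 h dh x y Hxy) as (c & E & Hc).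
  - intros c _; apply is_derive_Reals, Hd.
  - specialize (Hp c Hc); nra.
Qed.

Lemma derive_nonneg_incr (h dh : R -> R) x y :
  (forall t, is_derive h t (dh t)) -> (forall t, x < t < y -> 0 <= dh t) ->
  x <= y -> h x <= h y.
Proof.
  intros Hd Hp [Hxy|<-]; [|lra].
  destruct (MVT_cor2 h dh x y Hxy) as (c & E & Hc).
  - intros c _; apply is_derive_Reals, Hd.
  - specialize (Hp c Hc); nra.
Qed.

(* The integrating factor exp(-∫G) stays bounded at both ends, so its product
   with [D], which is strictly increasing, would vanish at both ends. *)
Lemma no_doubly_decaying_solution (D G P : R -> R) :
  (forall t, continuous G t) ->
  (forall t, is_derive D t (G t * D t + P t)) ->
  (forall t, 0 < P t) ->
  is_lim D m_infty 0 -> is_lim D p_infty 0 ->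
  Rbar_locally m_infty (fun t => G t <= 0) ->
  Rbar_locally p_infty (fun t => 0 <= G t) -> False.
Proof.
  intros HG HD HP Dm Dp [T1 Gm] [T2 Gp].
  set (K := fun t => exp (- RInt G 0 t)).
  assert (K0 : forall t, 0 < K t) by (intros; apply exp_pos).
  assert (HK : forall t, is_derive K t (- G t * K t)).
  { intros t; unfold K.
    assert (HI : is_derive (RInt G 0) t (G t)).
    { apply is_derive_RInt with 0; [|apply HG].
      apply filter_forall; intros x; apply RInt_correct, ex_RInt_continuous.
      intros; apply HG. }
    evar_last.
    - apply (is_derive_comp exp (fun t => - RInt G 0 t)); [apply is_derive_exp|].
      apply (is_derive_opp (RInt G 0)), HI.
    - unfold scal, opp; simpl; unfold mult; simpl; ring. }
  set (H := fun t => K t * D t).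
  assert (HH : forall t, is_derive H t (K t * P t)).
  { intros t; unfold H; evar_last.
    - apply (is_derive_mult K D t); [apply HK|apply HD|intros; apply Rmult_comm].
    - unfold plus, mult; simpl; ring. }
  assert (Hinc : forall x y, x < y -> H x < H y).
  { intros x y; apply derive_pos_incr with (1 := HH).
    intros t _; apply Rmult_lt_0_compat; auto. }
  (* As H increases strictly, either H stays above H 1 > 0 to the right of 1, or it stays below H 0
     < 0 to the left of 0. In each case K is bounded on that side, while D tends to 0 there, so K D
     becomes too small. *)
  destruct (Rlt_le_dec 0 (H 1)) as [H1|H1].
  - set (T := Rmax T2 1 + 1).
    pose proof (Rmax_l T2 1); pose proof (Rmax_r T2 1).
    assert (Kb : forall t, T <= t -> K t <= K T).
    { intros t Ht.
      enough (- K T <= - K t) by lra.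
      apply (derive_nonneg_incr (fun t => - K t) (fun t => G t * K t)); [| |lra].
      - intros x; evar_last; [apply (is_derive_opp K), HK|].
        unfold opp; simpl; ring.
      - intros x Hx; apply Rmult_le_pos; [apply Gp; unfold T in *; lra|].
        apply Rlt_le, K0. }
    assert (e0 : 0 < H 1 / K T) by (apply Rdiv_lt_0_compat; auto).
    apply is_lim_spec in Dp; destruct (Dp (mkposreal _ e0)) as [T' HT'].
    simpl in HT'.
    set (t := Rmax T T' + 1).
    pose proof (Rmax_l T T'); pose proof (Rmax_r T T').
    assert (Dt := HT' t ltac:(unfold t; lra)).
    assert (Kt := Kb t ltac:(unfold t; lra)).
    assert (Ht := Hinc 1 t ltac:(unfold t, T in *; lra)).
    rewrite Rminus_0_r in Dt; apply Rabs_lt_between in Dt.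
    assert (E : H 1 = K T * (H 1 / K T)) by (field; pose proof (K0 T); lra).
    pose proof (K0 t); pose proof (K0 T); unfold H at 2 in Ht; nra.
  - assert (H0 := Hinc 0 1 ltac:(lra)).
    set (T := Rmin T1 0 - 1).
    pose proof (Rmin_l T1 0); pose proof (Rmin_r T1 0).
    assert (Kb : forall t, t <= T -> K t <= K T).
    { intros t Ht.
      apply (derive_nonneg_incr K (fun t => - G t * K t)); [auto| |lra].
      intros x Hx; apply Rmult_le_pos; [|apply Rlt_le, K0].
      assert (G x <= 0) by (apply Gm; unfold T in *; lra); lra. }
    assert (e0 : 0 < - H 0 / K T) by (apply Rdiv_lt_0_compat; auto; lra).
    apply is_lim_spec in Dm; destruct (Dm (mkposreal _ e0)) as [T' HT'].
    simpl in HT'.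
    set (t := Rmin T T' - 1).
    pose proof (Rmin_l T T'); pose proof (Rmin_r T T').
    assert (Dt := HT' t ltac:(unfold t; lra)).
    assert (Kt := Kb t ltac:(unfold t; lra)).
    assert (Ht := Hinc t 0 ltac:(unfold t, T in *; lra)).
    rewrite Rminus_0_r in Dt; apply Rabs_lt_between in Dt.
    assert (E : - H 0 = K T * (- H 0 / K T)) by (field; pose proof (K0 T); lra).
    pose proof (K0 t); pose proof (K0 T); unfold H at 1 in Ht; nra.
Qed.

(** The value 1 at 0 gives the continuous extension. It keeps the coefficient of the equation for
    the difference of two angles continuous where the angles coincide. *)
Definition sinc (x : R) : R := if Req_dec_T x 0 then 1 else sin x / x.

Lemma sinc_mult x : sin x = x * sinc x.
Proof.
  unfold sinc; destruct Req_dec_T as [->|]; [rewrite sin_0; ring|field; auto].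
Qed.

Lemma sinc_0 : sinc 0 = 1.
Proof. unfold sinc; destruct Req_dec_T; lra. Qed.

Lemma continuous_sinc x : continuous sinc x.
Proof.
  destruct (Req_dec x 0) as [->|Hx].
  - unfold continuous; rewrite sinc_0.
    apply filterlim_locally; intros eps.
    assert (L := is_lim_sinc_0); apply is_lim_spec in L.
    destruct (L eps) as [d Hd]; exists d; intros y Hy.
    specialize (Hd y Hy).
    unfold sinc; destruct Req_dec_T as [_|Hy0]; [apply ball_center|apply Hd, Hy0].
  - apply continuous_ext_loc with (fun x => sin x / x).
    + assert (H : 0 < Rabs x) by (apply Rabs_pos_lt; auto).
      exists (mkposreal _ H); intros y Hy.
      unfold sinc; destruct Req_dec_T as [->|]; [|reflexivity].
      unfold ball in Hy; simpl in Hy; unfold AbsRing_ball, abs, minus, plus, opp in Hy.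
      simpl in Hy; rewrite Rplus_0_l, Rabs_Ropp in Hy; lra.
    + apply (ex_derive_continuous (fun x => sin x / x)); auto_derive; auto.
Qed.

(* The difference of the two angles satisfies a linear equation whose
   coefficient [G] tends to -1 and +1 at the two saddles. *)
Lemma connector_compare a E1 lam1 E2 lam2 (th Th1 Th2 : R -> R) :
  is_saddles_connector a E1 lam1 th Th1 ->
  is_saddles_connector a E2 lam2 th Th2 ->
  ~ (forall t, 0 < lam1 - lam2 + a * (E1 - E2) * sin (th t) * sin (Th2 t)).
Proof.
  intros (Ht & Hth & H1 & thm & T1m & thp & T1p) (_ & _ & H2 & _ & T2m & _ & T2p) HP.
  set (mid := fun t => (Th1 t + Th2 t) / 2).
  set (hd := fun t => (Th1 t - Th2 t) / 2).
  (* By the sum-to-product formulas, the differences of the sines and of the cosines are Th1 - Th2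
     times cos [mid] or - sin [mid], times [sinc] of [hd]. Collecting these factors gives G. *)
  set (G := fun t =>
    (- (1 - 2 * a * E1 * (sin (th t)) ^ 2) * cos (mid t)
     + 2 * a * sin (th t) * cos (th t) * sin (mid t)) * sinc (hd t)).
  assert (Cth : forall t, continuous th t)
    by (intros t; apply (ex_derive_continuous th); eexists; apply Hth).
  assert (C1 : forall t, continuous Th1 t)
    by (intros t; apply (ex_derive_continuous Th1); eexists; apply H1).
  assert (C2 : forall t, continuous Th2 t)
    by (intros t; apply (ex_derive_continuous Th2); eexists; apply H2).
  assert (Csin : forall x, continuous sin x)
    by (intros x; apply (ex_derive_continuous sin); eexists; apply is_derive_sin).
  assert (Ccos : forall x, continuous cos x)
    by (intros x; apply (ex_derive_continuous cos); eexists; apply is_derive_cos).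
  assert (LG : forall x (l l1 : R), is_lim th x l -> sin l = 0 ->
    is_lim Th1 x l1 -> is_lim Th2 x l1 -> is_lim G x (- cos l1)).
  { intros x l l1 L S L1 L2.
    assert (M : forall f g (p q : R), is_lim f x p -> is_lim g x q ->
      is_lim (fun t => f t * g t) x (p * q))
      by (intros; apply (is_lim_mult f g x p q); easy).
    assert (A : forall f g (p q : R), is_lim f x p -> is_lim g x q ->
      is_lim (fun t => f t + g t) x (p + q))
      by (intros; eapply (is_lim_plus f g x p q); easy).
    assert (O : forall f (p : R), is_lim f x p -> is_lim (fun t => - f t) x (- p))
      by (intros; apply (is_lim_opp f x p); easy).
    assert (Lm : is_lim mid x l1).
    { replace l1 with ((l1 + l1) * / 2) by field.
      unfold mid, Rdiv; apply M; [apply A; assumption|apply is_lim_const]. }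
    assert (Lh : is_lim hd x 0).
    { replace 0 with ((l1 + - l1) * / 2) by field.
      unfold hd, Rdiv, Rminus; apply M; [apply A; [|apply O]; assumption|].
      apply is_lim_const. }
    assert (Ls := is_lim_comp_continuous _ _ _ _ L (Csin l)).
    assert (Lc := is_lim_comp_continuous _ _ _ _ L (Ccos l)).
    assert (Lms := is_lim_comp_continuous _ _ _ _ Lm (Csin l1)).
    assert (Lmc := is_lim_comp_continuous _ _ _ _ Lm (Ccos l1)).
    assert (Lhs := is_lim_comp_continuous _ _ _ _ Lh (continuous_sinc 0)).
    rewrite S in Ls; rewrite sinc_0 in Lhs.
    (* The limit is spelled out in the shape of G, so that the limits of sums and products can be
       matched term by term. *)
    replace (- cos l1) with
      ((- (1 + - (2 * a * E1 * (0 * (0 * 1)))) * cos l1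
       + 2 * a * 0 * cos l * sin l1) * 1) by ring.
    unfold G; simpl pow; unfold Rminus.
    repeat lazymatch goal with
    | |- is_lim (fun _ => ?c) _ _ => apply is_lim_const
    | |- is_lim (fun t => @?f t * @?g t) _ _ => apply (M f g)
    | |- is_lim (fun t => @?f t + @?g t) _ _ => apply (A f g)
    | |- is_lim (fun t => - @?f t) _ _ => apply (O f)
    | _ => assumption
    end. }
  apply (no_doubly_decaying_solution (fun t => Th1 t - Th2 t) G (fun t =>
    2 * sin (th t) *
    (lam1 - lam2 + a * (E1 - E2) * sin (th t) * sin (Th2 t)))).
  - intros t; unfold G.
    assert (Cm : continuous mid t).
    { unfold mid, Rdiv.
      apply (continuous_mult (fun t => Th1 t + Th2 t) (fun _ => / 2));
        [apply @continuous_plus; auto|apply continuous_const]. }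
    assert (Ch : continuous hd t).
    { unfold hd, Rdiv.
      apply (continuous_mult (fun t => Th1 t - Th2 t) (fun _ => / 2));
        [apply @continuous_minus; auto|apply continuous_const]. }
    assert (S := continuous_comp th sin t (Cth t) (Csin _)).
    assert (C := continuous_comp th cos t (Cth t) (Ccos _)).
    assert (Sm := continuous_comp mid sin t Cm (Csin _)).
    assert (Cmm := continuous_comp mid cos t Cm (Ccos _)).
    assert (Shh := continuous_comp hd sinc t Ch (continuous_sinc _)).
    assert (M : forall f g : R -> R, continuous f t -> continuous g t ->
      continuous (fun t => f t * g t) t) by (intros; apply (continuous_mult f g); auto).
    assert (A : forall f g : R -> R, continuous f t -> continuous g t ->
      continuous (fun t => f t + g t) t) by (intros; apply (continuous_plus f g); auto).
    assert (O : forall f : R -> R, continuous f t ->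
      continuous (fun t => - f t) t) by (intros; apply (continuous_opp f); auto).
    simpl pow; unfold Rminus.
    repeat lazymatch goal with
    | |- continuous (fun _ => ?c) _ => apply continuous_const
    | |- continuous (fun t => @?f t * @?g t) _ => apply (M f g)
    | |- continuous (fun t => @?f t + @?g t) _ => apply (A f g)
    | |- continuous (fun t => - @?f t) _ => apply (O f)
    | _ => assumption
    end.
  - intros t; evar_last; [apply @is_derive_minus; [apply H1|apply H2]|].
    unfold minus, plus, opp, Theta_rhs, G; simpl.
    assert (X1 : Th1 t = mid t + hd t) by (unfold mid, hd; field).
    assert (X2 : Th2 t = mid t - hd t) by (unfold mid, hd; field).
    assert (D : 2 * hd t = Th1 t - Th2 t) by (unfold hd; field).
    rewrite <- D.
    replace (sin (Th1 t)) with (sin (Th2 t) + 2 * (cos (mid t) * (hd t * sinc (hd t))))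
      by (rewrite <- sinc_mult, X1, X2, sin_plus, sin_minus; ring).
    replace (cos (Th1 t)) with (cos (Th2 t) - 2 * (sin (mid t) * (hd t * sinc (hd t))))
      by (rewrite <- sinc_mult, X1, X2, cos_plus, cos_minus; ring).
    ring.
  - intros t; specialize (HP t); specialize (Ht t).
    pose proof (sin_gt_0 (th t) ltac:(lra) ltac:(lra)); nra.
  - replace (Finite 0) with (Finite (0 - 0)) by (f_equal; ring).
    apply (is_lim_minus Th1 Th2 m_infty 0 0); easy.
  - replace (Finite 0) with (Finite (- PI - - PI)) by (f_equal; ring).
    apply (is_lim_minus Th1 Th2 p_infty (- PI) (- PI)); easy.
  - assert (L := LG m_infty 0 0 thm sin_0 T1m T2m).
    rewrite cos_0 in L; apply is_lim_spec in L.
    (* Being within distance 1 of the limit -1 forces G to be negative. *)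
    destruct (L (mkposreal 1 Rlt_0_1)) as [T HT]; exists T; intros t Htt.
    specialize (HT t Htt); simpl in HT; apply Rabs_lt_between in HT; lra.
  - assert (L := LG p_infty PI (- PI) thp sin_PI T1p T2p).
    rewrite cos_neg, cos_PI in L; apply is_lim_spec in L.
    destruct (L (mkposreal 1 Rlt_0_1)) as [T HT]; exists T; intros t Htt.
    specialize (HT t Htt); simpl in HT; apply Rabs_lt_between in HT; lra.
Qed.

(** * Connectors from solutions of the linear system *)

Lemma sin_2atan x : sin (2 * atan x) = 2 * x / (1 + x ^ 2).
Proof.
  assert (P : 0 < 1 + x²) by (pose proof (Rle_0_sqr x); lra).
  assert (S := sqrt_sqrt _ (Rlt_le _ _ P)); assert (S0 := sqrt_lt_R0 _ P).
  rewrite sin_2a, sin_atan, cos_atan.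
  replace (1 + x ^ 2) with (1 + x²) by (unfold Rsqr; ring).
  rewrite <- S at 3; field; lra.
Qed.

Lemma cos_2atan x : cos (2 * atan x) = (1 - x ^ 2) / (1 + x ^ 2).
Proof.
  assert (P : 0 < 1 + x²) by (pose proof (Rle_0_sqr x); lra).
  assert (S := sqrt_sqrt _ (Rlt_le _ _ P)); assert (S0 := sqrt_lt_R0 _ P).
  rewrite cos_2a, sin_atan, cos_atan.
  replace (1 + x ^ 2) with (1 + x²) by (unfold Rsqr; ring).
  rewrite <- S at 5.
  replace (x ^ 2) with (x * x) by ring; field; lra.
Qed.

(** The solution of theta' = sin theta with value PI / 2 at time 0, so that the symmetry of the flow
    becomes the reflection t -> - t. *)
Definition theta0 (t : R) : R := 2 * atan (exp t).

Lemma theta0_derive t : is_derive theta0 t (sin (theta0 t)).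
Proof.
  unfold theta0; rewrite sin_2atan; evar_last.
  - apply (is_derive_scal (fun t => atan (exp t)) t 2).
    apply (is_derive_comp atan exp); [apply is_derive_atan|apply is_derive_exp].
  - unfold scal; simpl; unfold mult; simpl; unfold Rsqr; field.
    pose proof (exp_pos t); nra.
Qed.

Lemma theta0_opp t : theta0 (- t) = PI - theta0 t.
Proof.
  unfold theta0; rewrite exp_Ropp, atan_inv by apply exp_pos; lra.
Qed.

Lemma theta0_bound t : 0 < theta0 t < PI.
Proof.
  assert (P : forall t, 0 < theta0 t).
  { intros x; unfold theta0.
    pose proof (atan_increasing 0 (exp x) (exp_pos x)); rewrite atan_0 in *; lra. }
  split; [apply P|]; pose proof (P (- t)); rewrite theta0_opp in *; lra.
Qed.

Lemma is_lim_reflect (f : R -> R) (l : Rbar) :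
  is_lim f m_infty l -> is_lim (fun t => f (- t)) p_infty l.
Proof.
  intros H; apply (is_lim_comp f Ropp p_infty l m_infty); [exact H| |].
  - apply (is_lim_opp (fun t => t) p_infty p_infty), is_lim_id.
  - exists 0; discriminate.
Qed.

Lemma theta0_lim_m : is_lim theta0 m_infty 0.
Proof.
  replace 0 with (2 * atan 0) by (rewrite atan_0; ring).
  apply (is_lim_comp_continuous exp (fun x => 2 * atan x)); [apply is_lim_exp_m|].
  apply (ex_derive_continuous (fun x => 2 * atan x)).
  apply ex_derive_scal; eexists; apply is_derive_atan.
Qed.

(** Used with c = PI for theta and with c = - PI for Theta, to transfer the limit at one saddle to
    the other. *)
Lemma is_lim_PI_reflect (f g : R -> R) (c l l' : R) :
  l' = c - l -> (forall t, 0 < t -> g t = c - f (- t)) -> is_lim f m_infty l ->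
  is_lim g p_infty l'.
Proof.
  intros -> E L.
  apply is_lim_ext_loc with (fun t => c - f (- t)).
  { exists 0; intros t Ht; symmetry; auto. }
  apply (is_lim_minus (fun _ => c) (fun t => f (- t)) p_infty c l);
    [apply is_lim_const|apply is_lim_reflect, L|easy].
Qed.

Lemma theta0_lim_p : is_lim theta0 p_infty PI.
Proof.
  apply (is_lim_PI_reflect theta0 theta0 PI 0 PI); [ring| |apply theta0_lim_m].
  intros t _; rewrite theta0_opp; ring.
Qed.

(** The quantity exp (- t) tan (theta / 2) is conserved, so theta is a time translate of [theta0];
    the flow being autonomous, Theta can be translated along. All connectors then share one theta
    component, as [connector_compare] requires. *)
Lemma connector_normalize a E lam :
  has_saddles_connector a E lam -> exists Th, is_saddles_connector a E lam theta0 Th.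
Proof.
  intros (th & Th & Hb & Hth & HTh & L1 & L2 & L3 & L4).
  assert (S0 : forall t, 0 < sin (th t / 2)).
  { intros t; specialize (Hb t); apply sin_gt_0; lra. }
  assert (C0 : forall t, 0 < cos (th t / 2)).
  { intros t; specialize (Hb t); apply cos_gt_0; lra. }
  set (w := fun t => exp (- t) * tan (th t / 2)).
  assert (Hw : forall t, is_derive w t 0).
  { intros t; unfold w, tan; auto_derive.
    - assert (ex_derive th t) by (exists (sin (th t)); apply Hth).
      repeat split; auto; apply Rgt_not_eq, C0.
    - replace (Derive (fun x : R => th x) t) with (sin (th t))
        by (symmetry; apply is_derive_unique, Hth).
      specialize (C0 t).
      assert (Q := sin2_cos2 (th t / 2)); unfold Rsqr in Q.
      assert (D := sin_2a (th t / 2)).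
      replace (2 * (th t / 2)) with (th t) in D by field; rewrite D.
      change (th t * / 2) with (th t / 2).
      set (s := sin (th t / 2)) in *; set (c := cos (th t / 2)) in *.
      transitivity (exp (- t) * s / c * (s * s + c * c - 1)); [field; lra|].
      rewrite Q; ring. }
  assert (W : forall t, w t = w 0).
  { intros t; destruct (MVT_gen w 0 t (fun _ => 0)) as (c & _ & E0).
    - intros; apply Hw.
    - intros; apply derivable_continuous_pt; exists 0; apply is_derive_Reals, Hw.
    - lra. }
  assert (W0 : 0 < w 0).
  { unfold w; apply Rmult_lt_0_compat; [apply exp_pos|].
    apply Rdiv_lt_0_compat; auto. }
  set (c := ln (w 0)).
  assert (Eth : (fun t => th (t - c)) = theta0).
  { apply functional_extensionality; intros t; unfold theta0.
    assert (A : tan (th (t - c) / 2) = exp t).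
    { assert (X := W (t - c)); unfold w at 1 in X.
      replace (exp t) with (exp (t - c) * w 0).
      - rewrite <- X, <- Rmult_assoc, <- exp_plus.
        replace (t - c + - (t - c)) with 0 by ring; rewrite exp_0; ring.
      - rewrite <- (exp_ln (w 0)) by assumption.
        rewrite <- exp_plus; f_equal; unfold c; ring. }
    rewrite <- A, atan_tan; [field|]; specialize (Hb (t - c)); lra. }
  assert (Sh : forall f df : R -> R, (forall t, is_derive f t (df t)) ->
    forall t, is_derive (fun t => f (t - c)) t (df (t - c))).
  { intros f df Hf t; evar_last.
    - apply (is_derive_comp f (fun t => t - c)); [apply Hf|].
      apply (is_derive_minus (fun t => t) (fun _ => c));
        [apply is_derive_id|apply @is_derive_const].
    - unfold scal, minus, plus, opp, one, zero; simpl; unfold mult; simpl; ring. }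
  assert (Hm : filterlim (fun t => t - c) (Rbar_locally m_infty) (Rbar_locally m_infty)).
  { intros P [M HM]; exists (M + c); intros x Hx; apply HM; lra. }
  assert (Hp : filterlim (fun t => t - c) (Rbar_locally p_infty) (Rbar_locally p_infty)).
  { intros P [M HM]; exists (M + c); intros x Hx; apply HM; lra. }
  exists (fun t => Th (t - c)); rewrite <- Eth.
  refine (conj _ (conj _ (conj _ (conj _ (conj _ (conj _ _)))))).
  - intros t; apply Hb.
  - apply (Sh th (fun t => sin (th t)) Hth).
  - apply (Sh Th (fun t => Theta_rhs a E lam (th t) (Th t)) HTh).
  - apply filterlim_comp with (1 := Hm), L1.
  - apply filterlim_comp with (1 := Hm), L2.
  - apply filterlim_comp with (1 := Hp), L3.
  - apply filterlim_comp with (1 := Hp), L4.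
Qed.

(** Serves at time 0, where the half orbit leaving (0, 0) meets its mirror image. *)
Lemma is_derive_glue (f g : R -> R) x l :
  f x = g x -> is_derive f x l -> is_derive g x l ->
  is_derive (fun t => if Rle_dec t x then f t else g t) x l.
Proof.
  intros E Hf Hg; apply is_derive_Reals in Hf, Hg; apply is_derive_Reals.
  intros eps He; destruct (Hf eps He) as [d1 H1], (Hg eps He) as [d2 H2].
  assert (Hd : 0 < Rmin d1 d2) by (apply Rmin_pos; apply cond_pos).
  exists (mkposreal _ Hd); intros h Hh Hb; simpl in Hb.
  pose proof (Rmin_l d1 d2); pose proof (Rmin_r d1 d2).
  destruct (Rle_dec x x) as [_|]; [|lra].
  destruct (Rle_dec (x + h) x); [apply H1|rewrite E; apply H2]; auto; lra.
Qed.

(* In the coordinate x = exp t one has u = x^2/(1+x^2), and the angle is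
   -2 atan v with v = sqrt(u(1-u)) g(u)/f(u). *)
Definition half_angle a m E (x : R) : R :=
  let u := x ^ 2 / (1 + x ^ 2) in
  - 2 * atan (x / (1 + x ^ 2) * (sol_g a m E u / sol_f a m E u)).

(** The double-angle formulas for atan turn both sides into rational functions of exp t, f and g,
    and the linear system makes them equal. *)
Lemma half_angle_derive a m E t :
  0 < a < 1 / 2 -> 0 <= m <= 2 -> 0 <= E <= 1 ->
  sol_f a m E ((exp t) ^ 2 / (1 + (exp t) ^ 2)) <> 0 ->
  is_derive (fun t => half_angle a m E (exp t)) t
    (Theta_rhs a E (- m) (theta0 t) (half_angle a m E (exp t))).
Proof.
  intros Ha Hm HE HF.
  set (U := fun x => x ^ 2 / (1 + x ^ 2)).
  set (u := U (exp t)); change (sol_f a m E u <> 0) in HF.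
  assert (X0 := exp_pos t).
  assert (Hu : 0 < u < 1).
  { unfold u, U; split; [apply Rdiv_lt_0_compat; nra|].
    apply Rmult_lt_reg_r with (1 + (exp t) ^ 2); [nra|].
    unfold Rdiv; rewrite Rmult_assoc, Rinv_l; nra. }
  assert (Hu' : Rabs u < 1) by (rewrite Rabs_pos_eq; lra).
  assert (DF := sol_f_derive a m E u Ha Hm HE Hu').
  destruct (sol_g_ex_derive a m E u Ha Hm HE Hu') as [dG DG].
  assert (DUG := sol_ug_derive a m E u Ha Hm HE Hu').
  (* The product rule for u g gives g', since u > 0 here. *)
  assert (K : sol_g a m E u + u * dG = (m + a - 2 * a * u) / (1 - u) * sol_f a m E u
     + 2 * a * E * (u * sol_g a m E u)).
  { rewrite <- (is_derive_unique _ _ _ DUG); symmetry; apply is_derive_unique.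
    auto_derive; [exists dG; apply DG|].
    replace (Derive (fun x : R => sol_g a m E x) u) with dG
      by (symmetry; apply is_derive_unique, DG).
    ring. }
  unfold Theta_rhs, half_angle.
  replace (- 2 * atan (exp t / (1 + exp t ^ 2) *
      (sol_g a m E (exp t ^ 2 / (1 + exp t ^ 2)) /
       sol_f a m E (exp t ^ 2 / (1 + exp t ^ 2)))))
    with (- (2 * atan (exp t / (1 + exp t ^ 2) * (sol_g a m E u / sol_f a m E u))))
    by (unfold u, U; ring).
  rewrite sin_neg, cos_neg.
  unfold theta0; rewrite !sin_2atan, !cos_2atan.
  auto_derive.
  - change (exp t ^ 2 * / (1 + exp t ^ 2)) with u.
    assert (1 + exp t * (exp t * 1) <> 0) by nra.
    repeat split; auto; eexists; eassumption.
  - change (exp t ^ 2 * / (1 + exp t ^ 2)) with u.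
    change (exp t * (exp t * 1) * / (1 + exp t * (exp t * 1))) with u.
    replace (Derive (fun x : R => sol_g a m E x) u) with dG
      by (symmetry; apply is_derive_unique, DG).
    replace (Derive (fun x : R => sol_f a m E x) u) with
      (- 2 * a * E * sol_f a m E u - (m - a + 2 * a * u) * sol_g a m E u)
      by (symmetry; apply is_derive_unique, DF).
    replace dG with (((m + a - 2 * a * u) / (1 - u) * sol_f a m E u
     + 2 * a * E * (u * sol_g a m E u) - sol_g a m E u) / u)
      by (rewrite <- K; field; lra).
    set (F := sol_f a m E u) in *; set (G := sol_g a m E u) in *.
    clearbody F G; clear DF DG DUG K.
    unfold u, U in *; clear u U; set (X := exp t) in *; clearbody X.
    simpl pow; unfold Rsqr.
    field.
    assert (0 < 1 + X * X) by nra.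
    repeat split; nra.
Qed.

(** In the variable x = exp t the angle is differentiable at x = 0, because f = 1 at u = 0, and it
    vanishes there. *)
Lemma half_angle_lim a m E :
  0 < a < 1 / 2 -> 0 <= m <= 2 -> 0 <= E <= 1 ->
  is_lim (fun t => half_angle a m E (exp t)) m_infty 0.
Proof.
  intros Ha Hm HE.
  assert (Z0 : half_angle a m E 0 = 0).
  { unfold half_angle.
    replace (0 / (1 + 0 ^ 2)) with 0 by field.
    rewrite Rmult_0_l, atan_0; ring. }
  rewrite <- Z0; apply is_lim_comp_continuous; [apply is_lim_exp_m|].
  apply (ex_derive_continuous (half_angle a m E)); unfold half_angle.
  assert (H0 : Rabs 0 < 1) by (rewrite Rabs_R0; lra).
  auto_derive.
  replace (0 * (0 * 1) * / (1 + 0 * (0 * 1))) with 0 by field.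
  assert (ex_derive (fun x => sol_f a m E x) 0)
    by (eexists; apply sol_f_derive; auto).
  assert (ex_derive (fun x => sol_g a m E x) 0) by (apply sol_g_ex_derive; auto).
  assert (1 + 0 * (0 * 1) <> 0) by lra.
  rewrite sol_f_0; repeat split; auto; lra.
Qed.

(** The solution for t <= 0, where u <= 1/2 and f > 0, is continued to t >= 0 by the symmetry of the
    flow. The two halves meet because the boundary condition puts the angle at - PI / 2, the fixed
    point of Theta -> - PI - Theta. *)
Lemma connector_of_boundary_condition a m E :
  0 < a < 1 / 2 -> 0 <= m <= 2 -> 0 <= E <= 1 ->
  (forall u, 0 <= u <= 1 / 2 -> 0 < sol_f a m E u) ->
  sol_g a m E (1 / 2) = 2 * sol_f a m E (1 / 2) ->
  exists Th, is_saddles_connector a E (- m) theta0 Th.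
Proof.
  intros Ha Hm HE HF HB.
  set (L := fun t => half_angle a m E (exp t)).
  set (Th := fun t => if Rle_dec t 0 then L t else - PI - L (- t)).
  (* At t = 0 one has x = 1 and u = 1/2, and g = 2 f makes the argument of atan equal to 1. *)
  assert (L0 : L 0 = - PI / 2).
  { unfold L, half_angle; rewrite exp_0.
    replace (1 ^ 2 / (1 + 1 ^ 2)) with (1 / 2) by field.
    rewrite HB.
    replace (1 / (1 + 1 ^ 2) * _) with 1.
    - rewrite atan_1; field.
    - field; apply Rgt_not_eq, HF; lra. }
  assert (HL : forall t, t <= 0 ->
    is_derive L t (Theta_rhs a E (- m) (theta0 t) (L t))).
  { intros t Ht; apply half_angle_derive; auto.
    apply Rgt_not_eq, HF.
    assert (X0 := exp_pos t).
    assert (X1 : exp t <= 1).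
    { rewrite <- exp_0; destruct Ht as [Ht| ->];
        [left; apply exp_increasing, Ht|right; reflexivity]. }
    assert (0 < / (1 + exp t ^ 2)) by (apply Rinv_0_lt_compat; nra).
    split; [apply Rmult_le_pos; nra|].
    apply Rmult_le_reg_r with (1 + (exp t) ^ 2); [nra|].
    unfold Rdiv at 1; rewrite Rmult_assoc, Rinv_l; nra. }
  assert (HR : forall t, 0 <= t ->
    is_derive (fun t => - PI - L (- t)) t
      (Theta_rhs a E (- m) (theta0 t) (- PI - L (- t)))).
  { intros t Ht.
    assert (DN : is_derive Ropp t (- 1)) by (auto_derive; [exact I|ring]).
    evar_last.
    - apply (is_derive_minus (fun _ => - PI) (fun t => L (- t)));
        [apply @is_derive_const|].
      apply (is_derive_comp L Ropp); [apply HL; lra|apply DN].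
    - unfold minus, plus, opp, zero, scal; simpl; unfold mult; simpl.
      rewrite theta0_opp; unfold Theta_rhs.
      replace (sin (PI - theta0 t)) with (sin (theta0 t))
        by (rewrite sin_minus, sin_PI, cos_PI; ring).
      replace (cos (PI - theta0 t)) with (- cos (theta0 t))
        by (rewrite cos_minus, sin_PI, cos_PI; ring).
      replace (sin (- PI - L (- t))) with (sin (L (- t)))
        by (rewrite sin_minus, sin_neg, cos_neg, sin_PI, cos_PI; ring).
      replace (cos (- PI - L (- t))) with (- cos (L (- t)))
        by (rewrite cos_minus, sin_neg, cos_neg, sin_PI, cos_PI; ring).
      ring. }
  exists Th; refine (conj _ (conj _ (conj _ (conj _ (conj _ (conj _ _)))))).
  - apply theta0_bound.
  - apply theta0_derive.
  - intros t; destruct (Rtotal_order t 0) as [Ht|[->|Ht]].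
    + replace (Th t) with (L t) by (unfold Th; destruct Rle_dec; [auto|lra]).
      apply is_derive_ext_loc with L; [|apply HL; lra].
      assert (d : 0 < - t) by lra; exists (mkposreal _ d); intros y Hy.
      apply Rabs_lt_between in Hy; unfold minus, plus, opp in Hy; simpl in Hy.
      unfold Th; destruct Rle_dec; [auto|lra].
    + replace (Th 0) with (L 0) by (unfold Th; destruct Rle_dec; [auto|lra]).
      apply is_derive_glue.
      * rewrite Ropp_0, L0; field.
      * apply HL; lra.
      * replace (L 0) with (- PI - L (- 0)) by (rewrite Ropp_0, L0; field).
        apply HR; lra.
    + replace (Th t) with (- PI - L (- t))
        by (unfold Th; destruct Rle_dec; [lra|auto]).
      apply is_derive_ext_loc with (fun t => - PI - L (- t)); [|apply HR; lra].
      exists (mkposreal _ Ht); intros y Hy.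
      apply Rabs_lt_between in Hy; unfold minus, plus, opp in Hy; simpl in Hy.
      unfold Th; destruct Rle_dec; [lra|auto].
  - apply theta0_lim_m.
  - apply (is_lim_ext_loc L Th m_infty 0); [|apply half_angle_lim; auto].
    exists 0; intros t Ht; unfold Th; destruct Rle_dec; [auto|lra].
  - apply theta0_lim_p.
  - apply (is_lim_PI_reflect L Th (- PI) 0 (- PI));
      [ring| |apply half_angle_lim; auto].
    intros t Ht; unfold Th; destruct Rle_dec; [lra|auto].
Qed.

(** * Existence *)

(** The point is the supremum of the x such that h > 0 on all of [0, x]. *)
Lemma first_nonpos (h : R -> R) (u : R) :
  0 <= u -> (forall x, 0 <= x <= u -> continuity_pt h x) -> 0 < h 0 -> h u <= 0 ->
  exists u0, 0 < u0 <= u /\ h u0 <= 0 /\ (forall x, 0 <= x < u0 -> 0 < h x).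
Proof.
  intros Hu Hc H0 Hn.
  set (S := fun x => 0 <= x <= u /\ forall y, 0 <= y <= x -> 0 < h y).
  assert (S0 : S 0).
  { split; [lra|]; intros y Hy; replace y with 0 by lra; assumption. }
  destruct (completeness S) as [u0 [Ub Lub]].
  - exists u; intros x [Hx _]; lra.
  - exists 0; exact S0.
  - assert (U0 : 0 <= u0 <= u).
    { split; [apply Ub, S0|apply Lub; intros x [Hx _]; lra]. }
    assert (P : forall x, 0 <= x < u0 -> 0 < h x).
    { intros x Hx; apply Rnot_le_lt; intros Hx'.
      assert (u0 <= x); [|lra].
      apply Lub; intros y [Hy1 Hy2]; apply Rnot_lt_le; intros Hxy.
      specialize (Hy2 x ltac:(lra)); lra. }
    assert (N : h u0 <= 0).
    (* If h were positive at the supremum, continuity would extend positivity either past [u0] or up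
       to u, where h <= 0. *)
    { apply Rnot_lt_le; intros Hp.
      destruct (Hc u0 U0 (h u0) Hp) as [d [Hd Hcont]].
      assert (Q : forall y, Rabs (y - u0) < d -> 0 < h y).
      { intros y Hy; destruct (Req_dec y u0) as [->|Hyu]; [assumption|].
        assert (X := Hcont y (conj (conj I (not_eq_sym Hyu)) Hy)).
        simpl in X; unfold Rdist in X; apply Rabs_lt_between in X; lra. }
      set (x := Rmin u (u0 + d / 2)).
      pose proof (Rmin_l u (u0 + d / 2)); pose proof (Rmin_r u (u0 + d / 2)).
      assert (Sx : S x).
      { split; [unfold x; split; [apply Rmin_glb; lra|lra]|].
        intros y Hy; destruct (Rlt_le_dec y u0) as [Hyu|Hyu]; [apply P; lra|].
        apply Q, Rabs_lt_between; unfold x in Hy; lra. }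
      assert (X := Ub x Sx); unfold x in X, Sx.
      destruct (Rle_lt_dec u (u0 + d / 2)).
      - rewrite Rmin_left in Sx by assumption.
        pose proof (proj2 Sx u ltac:(lra)); lra.
      - rewrite Rmin_right in X by lra; lra. }
    exists u0; split; [|auto].
    split; [|lra].
    destruct (proj1 U0) as [|<-]; [assumption|lra].
Qed.

Lemma sol_continuity a m E u :
  0 < a < 1 / 2 -> 0 <= m <= 2 -> 0 <= E <= 1 -> 0 <= u <= 1 / 2 ->
  continuity_pt (sol_f a m E) u /\ continuity_pt (sol_g a m E) u.
Proof.
  intros Ha Hm HE Hu.
  assert (Rabs u < 1) by (rewrite Rabs_pos_eq; lra).
  split; apply derivable_continuous_pt, ex_derive_Reals_0.
  - eexists; apply sol_f_derive; auto.
  - apply sol_g_ex_derive; auto.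
Qed.

(** The integrating factor exp (- 2 a E u) makes the derivative of u g a positive multiple of f.
    Positivity of f is needed only before [u0], so the lemma applies at a first zero of f. *)
Lemma sol_g_pos a m E u0 :
  0 < a < 1 / 2 -> 1 - a <= m <= 1 + a -> 0 <= E <= 1 -> 0 <= u0 <= 1 / 2 ->
  (forall u, 0 <= u < u0 -> 0 < sol_f a m E u) ->
  0 < sol_g a m E u0.
Proof.
  intros Ha Hm HE Hu0 HF.
  destruct (Req_dec u0 0) as [->|N0]; [rewrite sol_g_0; lra|].
  destruct (MVT_cor2 (fun u => exp (- 2 * a * E * u) * (u * sol_g a m E u))
    (fun u => exp (- 2 * a * E * u) *
       ((m + a - 2 * a * u) / (1 - u) * sol_f a m E u)) 0 u0) as (c & Eq & Hc).
  - lra.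
  - intros c Hc; apply is_derive_Reals; evar_last.
    + apply (is_derive_mult (fun u => exp (- 2 * a * E * u))
        (fun u => u * sol_g a m E u)).
      * apply (is_derive_comp exp (fun u => - 2 * a * E * u));
          [apply is_derive_exp|apply (is_derive_scal (fun x => x)), is_derive_id].
      * apply sol_ug_derive; try lra; rewrite Rabs_pos_eq; lra.
      * intros; apply Rmult_comm.
    + unfold plus, mult, scal, one; simpl; unfold mult; simpl; ring.
  - assert (0 < exp (- 2 * a * E * c) *
       ((m + a - 2 * a * c) / (1 - c) * sol_f a m E c)).
    { apply Rmult_lt_0_compat; [apply exp_pos|].
      apply Rmult_lt_0_compat; [apply Rdiv_lt_0_compat; nra|apply HF; lra]. }
    pose proof (exp_pos (- 2 * a * E * u0)).
    assert (0 < exp (- 2 * a * E * u0) * (u0 * sol_g a m E u0)) by nra.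
    apply Rmult_lt_reg_l with (exp (- 2 * a * E * u0) * u0); [nra|]; nra.
Qed.

(* [u (f - (1 - u) g)] is the Wronskian with the explicit solution
   [f = 1 - u, g = 1] for [m = 1 - a, E = 1], whose connector is
   [Theta = - theta]. *)
Lemma sol_compare_explicit a m E u :
  0 < a < 1 / 2 -> 1 - a <= m <= 1 + a -> 0 <= E <= 1 -> 0 < u <= 1 / 2 ->
  exists c, 0 < c < u /\
  sol_f a m E u - (1 - u) * sol_g a m E u =
  - (m - 1 + a) * (sol_f a m E c + c * sol_g a m E c)
  + 2 * a * (1 - E) * c * (sol_f a m E c + (1 - c) * sol_g a m E c).
Proof.
  intros Ha Hm HE Hu.
  destruct (MVT_cor2 (fun u => u * sol_f a m E u - (1 - u) * (u * sol_g a m E u))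
    (fun c => - (m - 1 + a) * (sol_f a m E c + c * sol_g a m E c)
  + 2 * a * (1 - E) * c * (sol_f a m E c + (1 - c) * sol_g a m E c)) 0 u)
    as (c & Eq & Hc).
  - lra.
  - intros c Hc; apply is_derive_Reals.
    assert (Rabs c < 1) by (rewrite Rabs_pos_eq; lra).
    evar_last.
    + apply @is_derive_minus.
      * apply (is_derive_mult (fun u => u) (sol_f a m E));
          [apply is_derive_id|apply sol_f_derive; auto; lra|intros; apply Rmult_comm].
      * apply (is_derive_mult (fun u => 1 - u) (fun u => u * sol_g a m E u));
          [|apply sol_ug_derive; auto; lra|intros; apply Rmult_comm].
        apply (is_derive_minus (fun _ => 1) (fun u => u));
          [apply @is_derive_const|apply is_derive_id].
    + unfold minus, plus, opp, mult, one, zero; simpl; field; lra.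
  - exists c; split; [assumption|].
    apply Rmult_eq_reg_l with u; [|lra].
    lra.
Qed.

(** For m = 1 - a the first term of [sol_compare_explicit] vanishes and the second is nonnegative.
    At a first zero of f the left side would be negative, since g > 0 there. *)
Lemma sol_f_pos_lowest a E u :
  0 < a < 1 / 2 -> 0 <= E <= 1 -> 0 <= u <= 1 / 2 -> 0 < sol_f a (1 - a) E u.
Proof.
  intros Ha HE Hu; apply Rnot_le_lt; intros Hn.
  destruct (first_nonpos (sol_f a (1 - a) E) u) as (u0 & Hu0 & N & P).
  - lra.
  - intros x Hx; apply (sol_continuity a (1 - a) E x); lra.
  - rewrite sol_f_0; lra.
  - assumption.
  - assert (G : forall c, 0 <= c <= u0 -> 0 < sol_g a (1 - a) E c).
    { intros c Hc; apply sol_g_pos; try lra; intros x Hx; apply P; lra. }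
    destruct (sol_compare_explicit a (1 - a) E u0) as (c & Hc & Eq); try lra.
    specialize (P c ltac:(lra)).
    pose proof (G c ltac:(lra)); pose proof (G u0 ltac:(lra)).
    assert (0 <= 2 * a * (1 - E) * c) by (repeat apply Rmult_le_pos; lra).
    assert (0 < sol_f a (1 - a) E c + (1 - c) * sol_g a (1 - a) E c) by nra.
    assert (0 <= 2 * a * (1 - E) * c
      * (sol_f a (1 - a) E c + (1 - c) * sol_g a (1 - a) E c))
      by (apply Rmult_le_pos; lra).
    nra.
Qed.

(** Restores strict positivity after a passage to the limit. At an interior first zero, f' = - (m -
    a + 2 a u) g < 0 would make f negative just after; a zero at 1/2 would force g <= 0. *)
Lemma sol_f_pos_of_nonneg a m E :
  0 < a < 1 / 2 -> 1 - a <= m <= 1 + a -> 0 <= E <= 1 ->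
  (forall u, 0 <= u <= 1 / 2 -> 0 <= sol_f a m E u) ->
  sol_g a m E (1 / 2) <= 2 * sol_f a m E (1 / 2) ->
  forall u, 0 <= u <= 1 / 2 -> 0 < sol_f a m E u.
Proof.
  intros Ha Hm HE HF HB u Hu; apply Rnot_le_lt; intros Hn.
  destruct (first_nonpos (sol_f a m E) u) as (u0 & Hu0 & N & P).
  - lra.
  - intros x Hx; apply (sol_continuity a m E x); lra.
  - rewrite sol_f_0; lra.
  - assumption.
  - assert (G : 0 < sol_g a m E u0) by (apply sol_g_pos; auto; lra).
    assert (F0 := HF u0 ltac:(lra)).
    destruct (Req_dec u0 (1 / 2)) as [->|Hne]; [lra|].
    assert (D : is_derive (sol_f a m E) u0
      (- 2 * a * E * sol_f a m E u0 - (m - a + 2 * a * u0) * sol_g a m E u0))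
      by (apply sol_f_derive; try lra; rewrite Rabs_pos_eq; lra).
    replace (sol_f a m E u0) with 0 in D by lra.
    set (d := (m - a + 2 * a * u0) * sol_g a m E u0) in D.
    assert (d0 : 0 < d) by (apply Rmult_lt_0_compat; nra).
    apply is_derive_Reals in D; destruct (D d d0) as [del Hd].
    set (h := Rmin (del / 2) (1 / 2 - u0)).
    assert (h0 : 0 < h) by (apply Rmin_pos; [destruct del; simpl|]; lra).
    pose proof (Rmin_l (del / 2) (1 / 2 - u0)).
    pose proof (Rmin_r (del / 2) (1 / 2 - u0)).
    assert (h1 : Rabs h < del)
      by (rewrite Rabs_pos_eq; unfold h in *; destruct del; simpl in *; lra).
    assert (X := Hd h ltac:(lra) h1).
    apply Rabs_lt_between in X.
    assert (F1 := HF (u0 + h) ltac:(unfold h in *; lra)).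
    assert (0 <= (sol_f a m E (u0 + h) - sol_f a m E u0) / h); [|lra].
    apply Rdiv_le_0_compat; lra.
Qed.

(** With m = - lambda, the interval is the range prescribed for Lambda. The last condition says
    Theta = - PI / 2 when theta = PI / 2. *)
Definition boundary_solution a E m : Prop :=
  1 - a <= m <= 1 + a /\
  (forall u, 0 <= u <= 1 / 2 -> 0 < sol_f a m E u) /\
  sol_g a m E (1 / 2) = 2 * sol_f a m E (1 / 2).

Lemma boundary_solution_exists a E :
  0 < a < 1 / 2 -> 0 <= E <= 1 -> exists m, boundary_solution a E m.
Proof.
  intros Ha HE.
  set (S := fun m => 1 - a <= m <= 1 + a /\
    (forall u, 0 <= u <= 1 / 2 -> 0 < sol_f a m E u) /\
    sol_g a m E (1 / 2) <= 2 * sol_f a m E (1 / 2)).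
  assert (S0 : S (1 - a)).
  { assert (F : forall u, 0 <= u <= 1 / 2 -> 0 < sol_f a (1 - a) E u)
      by (intros; apply sol_f_pos_lowest; auto).
    split; [lra|split; [assumption|]].
    destruct (sol_compare_explicit a (1 - a) E (1 / 2)) as (c & Hc & Eq); try lra.
    assert (0 < sol_g a (1 - a) E c)
      by (apply sol_g_pos; try lra; intros; apply F; lra).
    specialize (F c ltac:(lra)).
    assert (0 <= 2 * a * (1 - E) * c
      * (sol_f a (1 - a) E c + (1 - c) * sol_g a (1 - a) E c))
      by (apply Rmult_le_pos; [repeat apply Rmult_le_pos|]; nra).
    lra. }
  destruct (completeness S) as [m [Ub Lub]].
  { exists (1 + a); intros x [Hx _]; lra. }
  { exists (1 - a); exact S0. }
  assert (Hm : 1 - a <= m <= 1 + a).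
  { split; [apply Ub, S0|apply Lub; intros x [Hx _]; lra]. }
  pose proof sol_bound_pos as C0.
  (* Elements of S approach the supremum; the distance is written as in [sol_lipschitz], with the
     same E on both sides. *)
  assert (App : forall eps, 0 < eps -> exists m', S m' /\
    (Rabs (m - m') + Rabs (E - E)) * sol_bound <= eps).
  { intros eps He.
    assert (e0 : 0 < eps / sol_bound) by (apply Rdiv_lt_0_compat; auto).
    destruct (classic (exists m', S m' /\ m - eps / sol_bound < m'))
      as [(m' & Sm & Hm')|N].
    - exists m'; split; [assumption|].
      pose proof (Ub m' Sm).
      rewrite Rminus_diag, Rabs_R0, Rplus_0_r, Rabs_pos_eq by lra.
      apply Rle_trans with (eps / sol_bound * sol_bound);
        [apply Rmult_le_compat_r; lra|right; field; lra].
    - exfalso; assert (m <= m - eps / sol_bound); [|lra].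
      apply Lub; intros x Sx; apply Rnot_lt_le; intros Hx; apply N; eauto. }
  assert (F0 : forall u, 0 <= u <= 1 / 2 -> 0 <= sol_f a m E u).
  { intros u Hu; apply Rnot_lt_le; intros Hn.
    destruct (App (- sol_f a m E u)) as (m' & (Hm' & SF & _) & Hd); [lra|].
    destruct (sol_lipschitz a m E m' E u) as [L _]; try lra.
    specialize (SF u Hu); apply Rabs_le_between in L; lra. }
  assert (B0 : sol_g a m E (1 / 2) <= 2 * sol_f a m E (1 / 2)).
  { apply Rnot_lt_le; intros Hn.
    (* An error eps in f and g changes g - 2 f by at most 3 eps, hence the division by 4. *)
    destruct (App ((sol_g a m E (1 / 2) - 2 * sol_f a m E (1 / 2)) / 4))
      as (m' & (Hm' & _ & SB) & Hd); [lra|].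
    destruct (sol_lipschitz a m E m' E (1 / 2)) as [L1 L2]; try lra.
    apply Rabs_le_between in L1, L2; lra. }
  assert (F : forall u, 0 <= u <= 1 / 2 -> 0 < sol_f a m E u)
    by (apply sol_f_pos_of_nonneg; auto).
  exists m; split; [assumption|split; [assumption|]].
  apply Rle_antisym; [assumption|apply Rnot_lt_le; intros Hlt].
  (* Suppose g < 2 f at 1/2. For m = 1 + a the explicit comparison gives f - g / 2 < 0, a
     contradiction. For m < 1 + a all conditions survive a small increase of m, against the choice
     of m as a supremum. *)
  destruct (Req_dec m (1 + a)) as [Em|Nm].
  - destruct (sol_compare_explicit a m E (1 / 2)) as (c & Hc & Eq); try lra.
    assert (0 < sol_g a m E c)
      by (apply sol_g_pos; try lra; intros; apply F; lra).
    specialize (F c ltac:(lra)).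
    set (f := sol_f a m E c) in *; set (g := sol_g a m E c) in *.
    assert (- (m - 1 + a) * (f + c * g) + 2 * a * (1 - E) * c * (f + (1 - c) * g)
      = - (2 * a) * (f * (1 - c) + c ^ 2 * g + E * (c * (f + (1 - c) * g))))
      by (rewrite Em; ring).
    assert (0 <= E * (c * (f + (1 - c) * g)))
      by (repeat apply Rmult_le_pos; nra).
    assert (0 < f * (1 - c)) by (apply Rmult_lt_0_compat; lra).
    assert (0 <= c ^ 2 * g) by (apply Rmult_le_pos; nra).
    nra.
  - destruct (continuity_ab_min (sol_f a m E) 0 (1 / 2)) as (um & Hmin & Hum).
    { lra. }
    { intros c Hc; apply (sol_continuity a m E c); lra. }
    set (mu := sol_f a m E um) in *.
    assert (mu0 : 0 < mu) by (apply F; auto).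
    (* The first bound keeps f above [mu] / 2, the second keeps g <= 2 f at 1/2. *)
    set (eps := Rmin (mu / 2) ((2 * sol_f a m E (1 / 2) - sol_g a m E (1 / 2)) / 4)).
    assert (e0 : 0 < eps) by (apply Rmin_pos; lra).
    assert (e1 : eps <= mu / 2) by apply Rmin_l.
    assert (e2 : eps <= (2 * sol_f a m E (1 / 2) - sol_g a m E (1 / 2)) / 4)
      by apply Rmin_r.
    set (dl := Rmin (1 + a - m) (eps / sol_bound)).
    assert (d0 : 0 < dl) by (apply Rmin_pos; [lra|apply Rdiv_lt_0_compat; auto]).
    assert (d1 : dl <= 1 + a - m) by apply Rmin_l.
    assert (d2 : dl <= eps / sol_bound) by apply Rmin_r.
    assert (Hd : (Rabs (m + dl - m) + Rabs (E - E)) * sol_bound <= eps).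
    { replace (m + dl - m) with dl by ring.
      rewrite Rminus_diag, Rabs_R0, Rplus_0_r, Rabs_pos_eq by lra.
      apply Rle_trans with (eps / sol_bound * sol_bound);
        [apply Rmult_le_compat_r; lra|right; field; lra]. }
    assert (m + dl <= m); [|lra].
    apply Ub; split; [lra|split].
    + intros u Hu.
      destruct (sol_lipschitz a (m + dl) E m E u) as [L _]; try lra.
      specialize (Hmin u Hu); fold mu in Hmin.
      apply Rabs_le_between in L; lra.
    + destruct (sol_lipschitz a (m + dl) E m E (1 / 2)) as [L1 L2]; try lra.
      apply Rabs_le_between in L1, L2; lra.
Qed.

(** * Dependence on the energy *)

(** If lam1 - lam2 exceeded a |E1 - E2|, the forcing in [connector_compare] would be positive
    everywhere, as the sines are bounded by 1. Taking E1 = E2 gives uniqueness. *)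
Lemma connector_lambda_lipschitz a E1 lam1 E2 lam2 Th1 Th2 :
  0 < a ->
  is_saddles_connector a E1 lam1 theta0 Th1 ->
  is_saddles_connector a E2 lam2 theta0 Th2 ->
  Rabs (lam1 - lam2) <= a * Rabs (E1 - E2).
Proof.
  assert (H : forall E1 lam1 E2 lam2 Th1 Th2, 0 < a ->
    is_saddles_connector a E1 lam1 theta0 Th1 ->
    is_saddles_connector a E2 lam2 theta0 Th2 ->
    lam1 - lam2 <= a * Rabs (E1 - E2)).
  { clear; intros E1 lam1 E2 lam2 Th1 Th2 Ha C1 C2.
    apply Rnot_lt_le; intros Hlt.
    apply (connector_compare a E1 lam1 E2 lam2 theta0 Th1 Th2 C1 C2).
    intros t.
    assert (B : Rabs (a * (E1 - E2) * sin (theta0 t) * sin (Th2 t))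
      <= a * Rabs (E1 - E2) * 1 * 1).
    { repeat apply Rabs_mult_le; try (apply Rabs_le, SIN_bound).
      - rewrite Rabs_pos_eq; lra.
      - right; reflexivity. }
    apply Rabs_le_between in B; lra. }
  intros Ha C1 C2.
  assert (H1 := H _ _ _ _ _ _ Ha C1 C2).
  assert (H2 := H _ _ _ _ _ _ Ha C2 C1).
  rewrite Rabs_minus_sym in H2; apply Rabs_le; lra.
Qed.

(** The coefficient of m2 - m1 in the integrated derivative of the Wronskian; [energy_form] is the
    coefficient of E2 - E1. *)
Definition lam_form (f1 g1 f2 g2 : R -> R) : R :=
  RInt (fun u => f1 u * f2 u / (1 - u) + u * (g1 u * g2 u)) 0 (1 / 2).

Definition energy_form a (f1 g1 f2 g2 : R -> R) : R :=
  RInt (fun u => 2 * a * u * (f1 u * g2 u + f2 u * g1 u)) 0 (1 / 2).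

Lemma lam_form_integrand_continuous (f1 g1 f2 g2 : R -> R) u :
  continuous f1 u -> continuous g1 u -> continuous f2 u -> continuous g2 u ->
  u < 1 ->
  continuous (fun u => f1 u * f2 u / (1 - u) + u * (g1 u * g2 u)) u.
Proof.
  intros F1 G1 F2 G2 Hu.
  apply (continuous_plus (fun u => f1 u * f2 u / (1 - u)) (fun u => u * (g1 u * g2 u))).
  - apply (continuous_mult (fun u => f1 u * f2 u) (fun u => / (1 - u))).
    + apply (continuous_mult f1 f2); auto.
    + apply (ex_derive_continuous (fun u => / (1 - u))); auto_derive; lra.
  - apply (continuous_mult (fun u => u) (fun u => g1 u * g2 u));
      [apply continuous_id|apply (continuous_mult g1 g2); auto].
Qed.

Lemma energy_form_integrand_continuous a (f1 g1 f2 g2 : R -> R) u :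
  continuous f1 u -> continuous g1 u -> continuous f2 u -> continuous g2 u ->
  continuous (fun u => 2 * a * u * (f1 u * g2 u + f2 u * g1 u)) u.
Proof.
  intros F1 G1 F2 G2.
  apply (continuous_mult (fun u => 2 * a * u) (fun u => f1 u * g2 u + f2 u * g1 u)).
  - apply (ex_derive_continuous (fun u => 2 * a * u)); auto_derive; auto.
  - apply (continuous_plus (fun u => f1 u * g2 u) (fun u => f2 u * g1 u));
      [apply (continuous_mult f1 g2)|apply (continuous_mult f2 g1)]; auto.
Qed.

Lemma sol_continuous a m E u :
  0 < a < 1 / 2 -> 0 <= m <= 2 -> 0 <= E <= 1 -> 0 <= u <= 1 / 2 ->
  continuous (sol_f a m E) u /\ continuous (sol_g a m E) u.
Proof.
  intros Ha Hm HE Hu; destruct (sol_continuity a m E u Ha Hm HE Hu).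
  split; apply continuity_pt_filterlim; assumption.
Qed.

Lemma ex_RInt_continuous_half (h : R -> R) :
  (forall u, 0 <= u <= 1 / 2 -> continuous h u) -> ex_RInt h 0 (1 / 2).
Proof.
  intros H; apply (@ex_RInt_continuous R_CompleteNormedModule); intros z.
  rewrite Rmin_left, Rmax_right by lra; apply H.
Qed.

Lemma wronskian_identity a m1 E1 m2 E2 :
  0 < a < 1 / 2 -> 0 <= m1 <= 2 -> 0 <= m2 <= 2 -> 0 <= E1 <= 1 -> 0 <= E2 <= 1 ->
  let f1 := sol_f a m1 E1 in let g1 := sol_g a m1 E1 in
  let f2 := sol_f a m2 E2 in let g2 := sol_g a m2 E2 in
  g1 (1 / 2) = 2 * f1 (1 / 2) -> g2 (1 / 2) = 2 * f2 (1 / 2) ->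
  (m1 - m2) * lam_form f1 g1 f2 g2 = (E2 - E1) * energy_form a f1 g1 f2 g2.
Proof.
  intros Ha Hm1 Hm2 HE1 HE2 f1 g1 f2 g2 B1 B2.
  assert (C1 := fun u => sol_continuous a m1 E1 u Ha Hm1 HE1).
  assert (C2 := fun u => sol_continuous a m2 E2 u Ha Hm2 HE2).
  fold f1 g1 in C1; fold f2 g2 in C2.
  set (p := fun u => f1 u * f2 u / (1 - u) + u * (g1 u * g2 u)).
  set (q := fun u => 2 * a * u * (f1 u * g2 u + f2 u * g1 u)).
  assert (Cp : forall u, 0 <= u <= 1 / 2 -> continuous p u)
    by (intros u Hu; destruct (C1 u Hu), (C2 u Hu);
        apply lam_form_integrand_continuous; [assumption..|lra]).
  assert (Cq : forall u, 0 <= u <= 1 / 2 -> continuous q u)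
    by (intros u Hu; destruct (C1 u Hu), (C2 u Hu);
        apply energy_form_integrand_continuous; assumption).
  set (Z := fun u => f1 u * (u * g2 u) - f2 u * (u * g1 u)).
  (* The same integral is computed twice: here as the increment of Z, which is 0 by the factor u at
     0 and by g = 2 f at 1/2, and then by linearity. *)
  assert (DZ : is_RInt (fun u => (m2 - m1) * p u + (E2 - E1) * q u) 0 (1 / 2)
    (minus (Z (1 / 2)) (Z 0))).
  { apply (@is_RInt_derive R_CompleteNormedModule); intros u;
      rewrite Rmin_left, Rmax_right by lra; intros Hu.
    - assert (Rabs u < 1) by (rewrite Rabs_pos_eq; lra).
      evar_last.
      + apply @is_derive_minus.
        * apply (is_derive_mult f1 (fun u => u * g2 u));
            [apply sol_f_derive|apply sol_ug_derive|intros; apply Rmult_comm]; auto.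
        * apply (is_derive_mult f2 (fun u => u * g1 u));
            [apply sol_f_derive|apply sol_ug_derive|intros; apply Rmult_comm]; auto.
      + unfold minus, plus, opp, mult; simpl; unfold p, q.
        fold f1 g1 f2 g2; field; lra.
    - apply (continuous_plus (fun u => (m2 - m1) * p u) (fun u => (E2 - E1) * q u)).
      + apply (continuous_scal_r (m2 - m1) p), Cp, Hu.
      + apply (continuous_scal_r (E2 - E1) q), Cq, Hu. }
  assert (DZ' : is_RInt (fun u => (m2 - m1) * p u + (E2 - E1) * q u) 0 (1 / 2)
    ((m2 - m1) * RInt p 0 (1 / 2) + (E2 - E1) * RInt q 0 (1 / 2))).
  { apply (is_RInt_plus (fun u => (m2 - m1) * p u) (fun u => (E2 - E1) * q u)).
    - apply (is_RInt_scal p), (RInt_correct p), ex_RInt_continuous_half, Cp.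
    - apply (is_RInt_scal q), (RInt_correct q), ex_RInt_continuous_half, Cq. }
  apply (@is_RInt_unique R_CompleteNormedModule) in DZ, DZ'; rewrite DZ in DZ'.
  unfold Z, minus, plus, opp in DZ'; simpl in DZ'; rewrite B1, B2 in DZ'.
  unfold lam_form, energy_form; fold p q; lra.
Qed.

Lemma form_difference_le (h1 h2 : R -> R) M :
  (forall u, 0 <= u <= 1 / 2 -> continuous h1 u) ->
  (forall u, 0 <= u <= 1 / 2 -> continuous h2 u) ->
  (forall u, 0 <= u <= 1 / 2 -> Rabs (h1 u - h2 u) <= M) ->
  Rabs (RInt h1 0 (1 / 2) - RInt h2 0 (1 / 2)) <= M.
Proof.
  intros C1 C2 HM.
  assert (I1 := ex_RInt_continuous_half _ C1).
  assert (I2 := ex_RInt_continuous_half _ C2).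
  assert (M0 : 0 <= M).
  { eapply Rle_trans; [apply Rabs_pos|apply (HM 0); lra]. }
  assert (Em : RInt h1 0 (1 / 2) - RInt h2 0 (1 / 2)
    = RInt (fun u => h1 u - h2 u) 0 (1 / 2)).
  { symmetry; apply (RInt_minus h1 h2); assumption. }
  rewrite Em.
  apply Rle_trans with ((1 / 2 - 0) * M); [|lra].
  apply abs_RInt_le_const; [lra| |assumption].
  apply (ex_RInt_minus h1 h2); assumption.
Qed.

(** Only the second pair varies; symmetry of the forms covers the first. The factor 3 is 2 + 1, from
    1 / (1 - u) <= 2 and u <= 1, and it also dominates the two terms of the energy form. *)
Lemma forms_lipschitz a (f1 g1 f2 g2 f3 g3 : R -> R) B d :
  0 < a < 1 / 2 -> 0 <= B -> 0 <= d ->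
  (forall u, 0 <= u <= 1 / 2 ->
    (continuous f1 u /\ continuous g1 u) /\ (continuous f2 u /\ continuous g2 u) /\
    (continuous f3 u /\ continuous g3 u) /\ (Rabs (f1 u) <= B /\ Rabs (g1 u) <= B) /\
    (Rabs (f2 u - f3 u) <= d * B /\ Rabs (g2 u - g3 u) <= d * B)) ->
  Rabs (lam_form f1 g1 f2 g2 - lam_form f1 g1 f3 g3) <= 3 * B ^ 2 * d /\
  Rabs (energy_form a f1 g1 f2 g2 - energy_form a f1 g1 f3 g3) <= 3 * B ^ 2 * d.
Proof.
  intros Ha HB Hd H.
  assert (BBd : 0 <= B * (d * B)) by (repeat apply Rmult_le_pos; lra).
  split; apply form_difference_le;
    try (intros u Hu; destruct (H u Hu) as ((C1 & C1') & (C2 & C2') & (C3 & C3') & _);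
    first [apply lam_form_integrand_continuous | apply energy_form_integrand_continuous];
      auto; lra);
    intros u Hu; destruct (H u Hu) as (_ & _ & _ & (F & G) & (DF & DG)).
  - replace (f1 u * f2 u / (1 - u) + u * (g1 u * g2 u) -
      (f1 u * f3 u / (1 - u) + u * (g1 u * g3 u)))
      with (/ (1 - u) * (f1 u * (f2 u - f3 u)) + u * (g1 u * (g2 u - g3 u)))
      by (field; lra).
    assert (I : Rabs (/ (1 - u)) <= 2).
    { rewrite Rabs_pos_eq by (left; apply Rinv_0_lt_compat; lra).
      replace 2 with (/ (1 / 2)) by field; apply Rinv_le_contravar; lra. }
    assert (P1 := Rabs_mult_le _ _ _ _ I (Rabs_mult_le _ _ _ _ F DF)).
    assert (P2 : Rabs (u * (g1 u * (g2 u - g3 u))) <= 1 * (B * (d * B))).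
    { apply Rabs_mult_le; [rewrite Rabs_pos_eq; lra|apply Rabs_mult_le; auto]. }
    eapply Rle_trans; [apply Rabs_triang|]; nra.
  - replace (2 * a * u * (f1 u * g2 u + f2 u * g1 u) -
      2 * a * u * (f1 u * g3 u + f3 u * g1 u))
      with (2 * a * u * (f1 u * (g2 u - g3 u)) + 2 * a * u * (g1 u * (f2 u - f3 u)))
      by ring.
    assert (I : Rabs (2 * a * u) <= 1) by (rewrite Rabs_pos_eq; nra).
    assert (P1 := Rabs_mult_le _ _ _ _ I (Rabs_mult_le _ _ _ _ F DG)).
    assert (P2 := Rabs_mult_le _ _ _ _ I (Rabs_mult_le _ _ _ _ G DF)).
    eapply Rle_trans; [apply Rabs_triang|]; nra.
Qed.

Lemma lam_form_sym f1 g1 f2 g2 : lam_form f1 g1 f2 g2 = lam_form f2 g2 f1 g1.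
Proof. unfold lam_form; apply RInt_ext; intros x _; unfold Rdiv; simpl; ring. Qed.

Lemma energy_form_sym a f1 g1 f2 g2 :
  energy_form a f1 g1 f2 g2 = energy_form a f2 g2 f1 g1.
Proof. unfold energy_form; apply RInt_ext; intros x _; simpl; ring. Qed.

Lemma forms_pos a (f1 g1 f2 g2 : R -> R) :
  0 < a ->
  (forall u, 0 <= u <= 1 / 2 ->
    (continuous f1 u /\ continuous g1 u) /\ (continuous f2 u /\ continuous g2 u) /\
    0 < f1 u /\ 0 < g1 u /\ 0 < f2 u /\ 0 < g2 u) ->
  0 < lam_form f1 g1 f2 g2 /\ 0 < energy_form a f1 g1 f2 g2.
Proof.
  intros Ha H.
  assert (Z : RInt (fun _ => 0) 0 (1 / 2) = 0)
    by (rewrite RInt_const; unfold scal; simpl; unfold mult; simpl; ring).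
  split; rewrite <- Z at 1; (apply RInt_lt; [lra| |intros; apply continuous_const|]);
    intros u Hu;
    destruct (H u ltac:(lra)) as ((C1 & C1') & (C2 & C2') & F1 & G1 & F2 & G2).
  - apply lam_form_integrand_continuous; auto; lra.
  - apply Rplus_lt_0_compat.
    + apply Rdiv_lt_0_compat; [apply Rmult_lt_0_compat; lra|lra].
    + repeat apply Rmult_lt_0_compat; lra.
  - apply energy_form_integrand_continuous; auto.
  - apply Rmult_lt_0_compat; [nra|].
    apply Rplus_lt_0_compat; apply Rmult_lt_0_compat; lra.
Qed.

(* AM-GM, since [u (1 - u) < 1/4] in the interior. *)
Lemma energy_form_lt a (f g : R -> R) :
  0 < a ->
  (forall u, 0 <= u <= 1 / 2 -> continuous f u /\ continuous g u /\ 0 < g u) ->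
  energy_form a f g f g < a * lam_form f g f g.
Proof.
  intros Ha H.
  assert (Ex : ex_RInt (fun u => f u * f u / (1 - u) + u * (g u * g u)) 0 (1 / 2)).
  { apply ex_RInt_continuous_half; intros u Hu.
    destruct (H u Hu) as (F & G & _); apply lam_form_integrand_continuous; auto; lra. }
  assert (E : a * lam_form f g f g =
    RInt (fun u => a * (f u * f u / (1 - u) + u * (g u * g u))) 0 (1 / 2)).
  { symmetry; apply (RInt_scal (fun u => f u * f u / (1 - u) + u * (g u * g u))), Ex. }
  rewrite E; apply RInt_lt; [lra| | |]; intros u Hu;
    destruct (H u ltac:(lra)) as (F & G & G0).
  - apply (continuous_scal_r a (fun u => f u * f u / (1 - u) + u * (g u * g u))).
    apply lam_form_integrand_continuous; auto; lra.
  - apply energy_form_integrand_continuous; auto.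
  - apply Rlt_0_minus.
    (* Completing the square in f leaves a multiple of (1 - 2 u)^2 g^2, which is positive for 0 < u
       < 1/2. *)
    replace (a * (f u * f u / (1 - u) + u * (g u * g u))
      - 2 * a * u * (f u * g u + f u * g u))
      with (a / (1 - u) * ((f u - 2 * (u * (1 - u)) * g u) ^ 2
        + u * (1 - u) * ((1 - 2 * u) ^ 2 * (g u) ^ 2))) by (field; lra).
    apply Rmult_lt_0_compat; [apply Rdiv_lt_0_compat; lra|].
    assert (0 < u * (1 - u) * ((1 - 2 * u) ^ 2 * (g u) ^ 2)).
    { repeat apply Rmult_lt_0_compat; try lra; apply pow_lt; lra. }
    pose proof (pow2_ge_0 (f u - 2 * (u * (1 - u)) * g u)); lra.
Qed.

(** Serves both for the limit of the difference quotient and for the continuity of the derivative,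
    with different sets D. *)
Lemma filterlim_lipschitz (X : R -> R) (D : R -> Prop) E l K :
  (forall x, D x -> Rabs (X x - l) <= K * Rabs (x - E)) ->
  filterlim X (within D (locally E)) (locally l).
Proof.
  intros H; apply filterlim_locally; intros eps.
  set (K' := Rabs K + 1).
  assert (K0 : 0 < K') by (unfold K'; pose proof (Rabs_pos K); lra).
  assert (d0 : 0 < eps / K') by (apply Rdiv_lt_0_compat; [apply cond_pos|auto]).
  exists (mkposreal _ d0); intros x Hx HD.
  unfold ball in *; simpl in *; unfold AbsRing_ball, abs, minus, plus, opp in *.
  simpl in *; fold (x - E) in Hx; fold (X x - l).
  apply Rle_lt_trans with (1 := H x HD).
  apply Rle_lt_trans with (K' * Rabs (x - E)).
  - apply Rmult_le_compat_r; [apply Rabs_pos|].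
    unfold K'; pose proof (Rle_abs K); lra.
  - replace (pos eps) with (K' * (eps / K')) by (field; lra).
    apply Rmult_lt_compat_l; assumption.
Qed.

Lemma filterlim_Rdiv {T} (F : (T -> Prop) -> Prop) {FF : Filter F} (f g : T -> R) x y :
  y <> 0 -> filterlim f F (locally x) -> filterlim g F (locally y) ->
  filterlim (fun t => f t / g t) F (locally (x / y)).
Proof.
  intros Hy Hf Hg.
  apply (filterlim_comp_2 (G := locally x) (H := locally (/ y)) f (fun t => / g t) Rmult);
    [assumption| |apply (@filterlim_mult R_AbsRing x (/ y))].
  apply filterlim_comp with (1 := Hg).
  apply (ex_derive_continuous Rinv); auto_derive; auto.
Qed.

(** * The function Lambda, its monotonicity and its derivative *)

Theorem theorem7 (a : R) (ha : 0 < a < 1 / 2) :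
  exists Lam Lam' : R -> R,
    (forall E, I01 E ->
       (- 1 - a <= Lam E <= - 1 + a) /\
       has_saddles_connector a E (Lam E) /\
       (forall lam, - 1 - a <= lam <= - 1 + a ->
          has_saddles_connector a E lam -> lam = Lam E)) /\
    (forall E1 E2, I01 E1 -> I01 E2 -> E1 < E2 -> Lam E1 < Lam E2) /\
    is_derive_on_01 Lam Lam' /\
    continuous_on_01 Lam' /\
    (forall E, I01 E -> Lam' E < a).
Proof.
  (* A boundary solution is chosen for each E; Lambda is - [M]. *)
  set (M := fun E => epsilon (inhabits 0) (boundary_solution a E)).
  assert (HM : forall E, I01 E -> boundary_solution a E (M E)).
  { intros E HE; apply epsilon_spec, boundary_solution_exists; auto. }
  assert (Mb : forall E, I01 E -> 0 <= M E <= 2)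
    by (intros E HE; destruct (HM E HE); lra).
  assert (Conn : forall E, I01 E ->
    exists Th, is_saddles_connector a E (- M E) theta0 Th).
  { intros E HE; destruct (HM E HE) as (Hm & HF & HB).
    apply connector_of_boundary_condition; auto. }
  set (f := fun E => sol_f a (M E) E); set (g := fun E => sol_g a (M E) E).
  set (P := fun E E' => lam_form (f E) (g E) (f E') (g E')).
  set (Q := fun E E' => energy_form a (f E) (g E) (f E') (g E')).
  assert (Cont : forall E u, I01 E -> 0 <= u <= 1 / 2 ->
    continuous (f E) u /\ continuous (g E) u).
  { intros E u HE Hu; exact (sol_continuous a (M E) E u ha (Mb E HE) HE Hu). }
  assert (Pos : forall E u, I01 E -> 0 <= u <= 1 / 2 -> 0 < f E u /\ 0 < g E u).
  { intros E u HE Hu; destruct (HM E HE) as (Hm & HF & HB).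
    split; [apply HF, Hu|apply (sol_g_pos a (M E) E u ha Hm HE Hu)].
    intros x Hx; apply HF; lra. }
  assert (PQpos : forall E E', I01 E -> I01 E' -> 0 < P E E' /\ 0 < Q E E').
  { intros E E' HE HE'.
    apply (forms_pos a (f E) (g E) (f E') (g E') (proj1 ha)); intros u Hu.
    destruct (Pos E u HE Hu) as [F1 G1], (Pos E' u HE' Hu) as [F2 G2].
    exact (conj (Cont E u HE Hu) (conj (Cont E' u HE' Hu)
      (conj F1 (conj G1 (conj F2 G2))))). }
  (* The Wronskian identity gives the difference quotient exactly, as a ratio of positive forms.
     Monotonicity follows at once, and the derivative is the ratio on the diagonal. *)
  assert (Slope : forall E E', I01 E -> I01 E' ->
    - M E' - - M E = (E' - E) * (Q E E' / P E E')).
  { intros E E' HE HE'; destruct (PQpos E E' HE HE') as [P0 _].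
    destruct (HM E HE) as (_ & _ & B), (HM E' HE') as (_ & _ & B').
    assert (W := wronskian_identity a (M E) E (M E') E' ha (Mb E HE) (Mb E' HE')
      HE HE' B B').
    apply Rmult_eq_reg_r with (P E E'); [|lra].
    transitivity ((E' - E) * Q E E'); [|field; lra].
    change ((M E - M E') * P E E' = (E' - E) * Q E E') in W.
    rewrite <- W; ring. }
  (* The last factor 2 comes from |M E1 - M E2| + |E1 - E2| <= (a + 1) |E1 - E2|. *)
  set (K := 3 * sol_bound ^ 2 * 2).
  assert (Lip : forall E E1 E2, I01 E -> I01 E1 -> I01 E2 ->
    Rabs (P E E1 - P E E2) <= K * Rabs (E1 - E2) /\
    Rabs (Q E E1 - Q E E2) <= K * Rabs (E1 - E2)).
  { intros E E1 E2 HE HE1 HE2.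
    unfold K; rewrite Rmult_assoc.
    pose proof sol_bound_pos; pose proof (Rabs_pos (E1 - E2)).
    apply (forms_lipschitz a (f E) (g E) (f E1) (g E1) (f E2) (g E2) sol_bound
      (2 * Rabs (E1 - E2)) ha); [lra|lra|]; intros u Hu.
    assert (D : Rabs (M E1 - M E2) + Rabs (E1 - E2) <= 2 * Rabs (E1 - E2)).
    { destruct (Conn E1 HE1) as [Th1 C1], (Conn E2 HE2) as [Th2 C2].
      assert (L := connector_lambda_lipschitz a _ _ _ _ _ _ (proj1 ha) C1 C2).
      replace (- M E1 - - M E2) with (- (M E1 - M E2)) in L by ring.
      rewrite Rabs_Ropp in L; nra. }
    destruct (sol_lipschitz a (M E1) E1 (M E2) E2 u) as [L1 L2]; auto.
    refine (conj (Cont E u HE Hu) (conj (Cont E1 u HE1 Hu)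
      (conj (Cont E2 u HE2 Hu) (conj _ (conj _ _))))).
    - apply (sol_bounded a (M E) E u ha (Mb E HE) HE Hu).
    - apply Rle_trans with (1 := L1), Rmult_le_compat_r; lra.
    - apply Rle_trans with (1 := L2), Rmult_le_compat_r; lra. }
  exists (fun E => - M E), (fun E => Q E E / P E E).
  refine (conj _ (conj _ (conj _ (conj _ _)))).
  - intros E HE; destruct (HM E HE) as (Hm & _), (Conn E HE) as [Th C].
    split; [lra|split; [exists theta0, Th; exact C|]].
    intros lam _ Hlam; destruct (connector_normalize a E lam Hlam) as [Th' C'].
    assert (L := connector_lambda_lipschitz a _ _ _ _ _ _ (proj1 ha) C' C).
    rewrite Rminus_diag, Rabs_R0, Rmult_0_r in L.
    apply Rabs_le_between in L; lra.
  - intros E1 E2 HE1 HE2 Hlt; assert (S := Slope E1 E2 HE1 HE2).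
    destruct (PQpos E1 E2 HE1 HE2).
    assert (0 < (E2 - E1) * (Q E1 E2 / P E1 E2)); [|lra].
    apply Rmult_lt_0_compat; [lra|apply Rdiv_lt_0_compat; assumption].
  - intros E HE; destruct (PQpos E E HE HE).
    apply filterlim_within_ext with (fun x => Q E x / P E x).
    { intros x [Hx Hne]; rewrite (Slope E x HE Hx); field.
      destruct (PQpos E x HE Hx); lra. }
    apply (filterlim_Rdiv _ (Q E) (P E)); [lra| |];
      apply filterlim_lipschitz with K; intros x [Hx _];
      destruct (Lip E x E HE Hx HE); assumption.
  - intros E HE; destruct (PQpos E E HE HE).
    apply (filterlim_Rdiv _ (fun x => Q x x) (fun x => P x x)); [lra| |];
      (* On the diagonal both arguments move; they are changed one at a time, using the symmetry of
         the forms. *)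
      apply filterlim_lipschitz with (K + K); intros x Hx;
      destruct (Lip x x E Hx Hx HE) as [LP LQ], (Lip E x E HE Hx HE) as [LP' LQ'].
    + assert (Q E x = Q x E)
        by (apply (energy_form_sym a (f E) (g E) (f x) (g x))).
      apply Rabs_le_between in LQ, LQ'; apply Rabs_le; lra.
    + assert (P E x = P x E)
        by (apply (lam_form_sym (f E) (g E) (f x) (g x))).
      apply Rabs_le_between in LP, LP'; apply Rabs_le; lra.
  - intros E HE; destruct (PQpos E E HE HE).
    apply Rmult_lt_reg_r with (P E E); [assumption|].
    replace (Q E E / P E E * P E E) with (Q E E) by (field; lra).
    apply (energy_form_lt a (f E) (g E) (proj1 ha)); intros u Hu.
    destruct (Cont E u HE Hu) as [F G], (Pos E u HE Hu) as [_ G0].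
    exact (conj F (conj G G0)).
Qed.
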